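(* Let $G$ be a countable discrete amenable group, $\{X_g\}_{g\in G}$ a finite-valued ergodic $G$-process with entropy $h$, and $\{F_n\}$ a tempered Følner sequence in $G$ with $|F_n|\ge n$. Let $\{W_n\}$ be a sequence of finite subsets of $G$ containing $1_G$ such that each $W_n$ is individually $C_n$-filling, and let $\{n(k)\}$ be a sequence of integers such that $\sum_{k=1}^\infty\frac{2^{-\alpha|F_k|}}{C_{n(k)}}<\infty$ for every $\alpha>0$. Then for almost every $x$, \[ \limsup_{k\to\infty}-\frac{1}{|F_k|}\log U^{(F,W)}_{k,n(k)}(x)\le h. \]
   Context: Setting: $\Sigma$ finite, $(\Omega,\mathcal F,P)$ a standard probability space with an ergodic measure-preserving free left $G$-action, $x(g)=X(gx)$ for measurable $X:\Omega\to\Sigma$; $h=\lim_k\frac1{|F_k|}H(\{X_g\}_{g\in F_k})$; logs base 2. $[x(E)]=\{x':x'(f)=x(f)\ \forall f\in E\}$. Tempered Følner: $|F_n\triangle gF_n|/|F_n|\to0$ for all $g$ and $|(\bigcup_{k<n}F_k^{-1})F_n|\le C|F_n|$. $x(F_k)$ repeats at $f$ if $fx\in[x(F_k)]$. $U_{k,n}^{(F,W)}(x)=\frac{1}{|W_n|}\max\{|E|: 1_G\in E\subseteq W_n,\ \{F_kf\}_{f\in E}\text{ pairwise disjoint},\ x(F_k)\text{ repeats at every }f\in E\}$. A finite set $W\ni1_G$ is individually $C$-filling if for every sequence $\{Wf_i\}_{i=1}^I$ with $f_i\notin\bigcup_{j<i}Wf_j$ one has $|\bigcup_iWf_i|\ge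 C\sum_i|Wf_i|$. *)

(* Defs.v *)
From HB Require Import structures.
From mathcomp Require Import all_boot all_order all_algebra.
From mathcomp Require Import finmap.
From mathcomp Require Import all_classical all_reals all_analysis.
From mathcomp Require Import monoid.

Set Implicit Arguments.
Unset Strict Implicit.
Unset Printing Implicit Defensive.

Import Order.TTheory GRing.Theory Num.Theory.
Import numFieldNormedType.Exports.
Local Open Scope classical_set_scope.
Local Open Scope ring_scope.
Local Open Scope fset_scope.

Definition log2 {R : realType} (x : R) : R := ln x / ln 2.

Section Setting.
Variable G : groupType.
Variable R : realType.

Definition frmul (A : {fset G}) (g : G) : {fset G} := [fset (a * g)%g | a in A].
Definition flmul (g : G) (A : {fset G}) : {fset G} := [fset (g * a)%g | a in A].
Definition finvs (A : {fset G}) : {fset G} := [fset (a^-1)%g | a in A].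
Definition fprod (A B : {fset G}) : {fset G} := [fset (a * b)%g | a in A, b in B].
Definition fbigcup_lt (A : nat -> {fset G}) (n : nat) : {fset G} :=
  \big[fsetU/fset0]_(1 <= k < n) A k.

Definition countable_group : Prop := exists f : G -> nat, injective f.

Definition tempered_folner (F : nat -> {fset G}) : Prop :=
  (forall g : G,
     (fun n => (#|` (F n `\` flmul g (F n)) `|` (flmul g (F n) `\` F n)|%:R
                / (#|` F n|)%:R : R) ) @ \oo --> (0 : R)) /\
  (exists C : R, forall n, (1 <= n)%N ->
     (#|` fprod (fbigcup_lt (fun k => finvs (F k)) n) (F n)|%:R : R)
       <= C * (#|` F n|)%:R).
End Setting.

Section Process.
Variables (G : groupType) (R : realType) (d : measure_display) (T : measurableType d).
Variables (P : probability T R) (act : G -> T -> T).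
Variables (Sigma : finType) (X : T -> Sigma).

Definition mp_action : Prop :=
  (forall x, act 1%g x = x) /\
  (forall g g' x, act (g * g')%g x = act g (act g' x)) /\
  (forall g, measurable_fun setT (act g)) /\
  (forall g A, measurable A -> P (act g @^-1` A) = P A).

Definition free_action : Prop := forall g x, act g x = x -> g = 1%g.

Definition ergodic_action : Prop :=
  forall A, measurable A -> (forall g, act g @^-1` A = A) ->
    P A = 0%E \/ P A = 1%E.

Definition measurable_obs : Prop := forall s : Sigma, measurable (X @^-1` [set s]).

(* probability of the pattern w on the finite set F: P{x : x(g) = w g, g in F},
   where x(g) = X (g x) *)
Definition pat_prob (F : {fset G}) (w : {ffun F -> Sigma}) : R :=
  fine (P [set x | forall g : F, X (act (fsval g) x) = w g]).

Definition block_entropy (F : {fset G}) : R :=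
  \sum_(w : {ffun F -> Sigma}) - (pat_prob w * log2 (pat_prob w)).

Definition repeats (F : {fset G}) (x : T) (f : G) : bool :=
  [forall g : F, X (act (fsval g) (act f x)) == X (act (fsval g) x)].

Definition admissible (F W : {fset G}) (x : T) (E : {set W}) : bool :=
  [&& [exists e in E, fsval e == 1%g],
      [forall e in E, forall e' in E,
         (e != e') ==> [disjoint frmul F (fsval e) & frmul F (fsval e')]%fset] &
      [forall e in E, repeats F x (fsval e)]].

(* U^{(F,W)}_{k,n}(x) with F := F_k, W := W_n *)
Definition Ufun (F W : {fset G}) (x : T) : R :=
  (\max_(E : {set W} | admissible F x E) #|E|)%:R / (#|` W|)%:R.
End Process.

Definition individually_filling (G : groupType) (R : realType)
    (W : {fset G}) (C : R) : Prop :=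
  forall s : seq G,
    (forall i, (i < size s)%N ->
       nth 1%g s i \notin \big[fsetU/fset0]_(j < i) frmul W (nth 1%g s j)) ->
    C * (\sum_(f <- s) #|` frmul W f|)%:R
      <= (#|` \big[fsetU/fset0]_(f <- s) frmul W f|)%:R.

(* Main.v *)
Require Import Defs.
From HB Require Import structures.
From mathcomp Require Import all_boot all_order all_algebra.
From mathcomp Require Import finmap.
From mathcomp Require Import all_classical all_reals all_analysis.
From mathcomp Require Import monoid.
From mathcomp Require Import measurable_realfun.
From mathcomp Require Import ring lra.
Import Order.TTheory GRing.Theory Num.Theory.
Import numFieldNormedType.Exports.
Local Open Scope classical_set_scope.
Local Open Scope ring_scope.

(** The heart of the matter is the upper half of the Shannon-McMillan-Breiman
    theorem: for every [dl > 0] there are at most [2^((h + dl)|F_k|)] typical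
    words on [F_k], and almost every [x] eventually carries a typical one.  Fix
    [K = F_m] with entropy rate close to [h] and let [p] be the law of [x(K)].
    Finner's generalized Hoelder inequality, applied to the translates [Kf]
    contained in [F_k] (every point lies in at most [|K|] of them), bounds by
    [2^(o(|F_k|))] the total mass of the weight
      [Q(y) = prod_f p(y(Kf))^(1/|K|)]
    on words [y] over [F_k], so few words have a large weight.  By the pointwise
    ergodic theorem, [-log Q(x(F_k)) / |F_k|] is eventually at most about
    [H(x(K)) / |K|].

    The ergodic theorem along the tempered sequence combines a weak (1,1) maximal
    inequality, obtained from a fractional version of Lindenstrauss' covering
    lemma, with a mean ergodic theorem: in the convex hull of the translates of
    [f], functions of almost minimal [L^2] norm are almost constant.

    For a typical word [w], the times [g] in a very invariant set [V] at which
    [gx] carries [w] but returns to it too rarely are covered by translates [W f]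
    with few such times each; since [W] is [C]-filling, they number at most
    [2|V|/C] times the return frequency, up to a factor polynomial in [|F_k|].
    Summing over the typical words and integrating bounds the probability of rare
    return by [2^(-a|F_k|)/C], and Borel-Cantelli concludes. *)

Set Implicit Arguments.
Unset Strict Implicit.
Unset Printing Implicit Defensive.

(** * Finner's inequality *)

Section Finner.
Variables (R : realType) (I Sg J : finType).
Implicit Types (psi : {ffun I -> Sg} -> R) (y : {ffun I -> Sg}) (g : I).

(** Weighted AM-GM with weights [1/r], the weight left over by [A] going to the value [1 = expR 0].
    The tangent of [expR] at the weighted mean [S] lies below the graph, and the average of the
    tangent values is [expR S]. *)
Lemma expR_weighted_AGM (A : {pred J}) (t : J -> R) (r : nat) :
  (0 < r)%N -> (#|A| <= r)%N ->
  expR (\sum_(j in A) t j / r%:R) <=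
    1 - #|A|%:R / r%:R + \sum_(j in A) expR (t j) / r%:R.
Proof.
move=> r0 Ar; set S := \sum_(j in A) _.
have r0R : 0 < r%:R :> R by rewrite ltr0n.
have tan u : expR S * (1 + (u - S)) <= expR u.
  by rewrite -{2}[u](subrKC S) expRD ler_pM2l ?expR_gt0// expR_ge1Dx.
have w0 : 0 <= 1 - #|A|%:R / r%:R :> R.
  by rewrite subr_ge0 ler_pdivrMr// mul1r ler_nat.
have -> : expR S = (1 - #|A|%:R / r%:R) * (expR S * (1 + (0 - S))) +
    \sum_(j in A) expR S * (1 + (t j - S)) / r%:R.
  rewrite -mulr_suml -mulr_sumr big_split/= sumr_const sumrB sumr_const.
  have -> : \sum_(j in A) t j = r%:R * S.
    by rewrite /S -mulr_suml mulrCA divff ?mulr1// gt_eqF.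
  by rewrite -mulr_natr; field; rewrite gt_eqF.
apply: lerD.
  by rewrite -[leRHS]mulr1 ler_wpM2l// (le_trans (tan 0))// expR0.
by apply: ler_sum => j _; rewrite ler_wpM2r// invr_ge0 ltW.
Qed.

Hypothesis Sg0 : (0 < #|Sg|)%N.

Definition upd y g (s : Sg) : {ffun I -> Sg} :=
  [ffun i => if i == g then s else y i].

(** Averaging over the letter at [g], conjugated by [expR]: weights are kept as logarithms, so that
    products with exponents [1/r] become scaled sums and positivity is automatic. *)
Definition lavg g psi y : R :=
  ln ((\sum_s expR (psi (upd y g s))) / #|Sg|%:R).

Definition lavgs (s : seq I) psi := foldr lavg psi s.

Definition indep g psi := forall y s, psi (upd y g s) = psi y.

Let N0 : 0 < #|Sg|%:R :> R. Proof. by rewrite ltr0n. Qed.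

Lemma sum_expR_gt0 (f : Sg -> R) : 0 < \sum_s expR (f s).
Proof.
have /card_gt0P[s _] := Sg0.
by rewrite (bigD1 s)//= ltr_pwDl ?expR_gt0// sumr_ge0.
Qed.

Lemma expR_lavg g psi y :
  expR (lavg g psi y) = (\sum_s expR (psi (upd y g s))) / #|Sg|%:R.
Proof. by rewrite lnK// posrE divr_gt0// sum_expR_gt0. Qed.

Lemma updK y g s t : upd (upd y g s) g t = upd y g t.
Proof. by apply/ffunP => i; rewrite !ffunE; case: eqP. Qed.

Lemma updC y g g' s t : g != g' ->
  upd (upd y g s) g' t = upd (upd y g' t) g s.
Proof.
move=> gg'; apply/ffunP => i; rewrite !ffunE.
by case: eqP => // ->; rewrite eq_sym (negbTE gg').
Qed.

Lemma le_lavg g psi psi' : (forall y, psi y <= psi' y) ->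
  forall y, lavg g psi y <= lavg g psi' y.
Proof.
move=> h y; rewrite -ler_expR !expR_lavg ler_pM2r ?invr_gt0//.
by apply: ler_sum => s _; rewrite ler_expR.
Qed.

Lemma indep_lavgs g psi s : indep g psi -> indep g (lavgs s psi).
Proof.
move=> h; elim: s => [//|g' s ih] y t /=; rewrite /lavg.
congr (ln (_ / _)); apply: eq_bigr => u _.
have [->|ne] := eqVneq g g'; first by rewrite updK.
by rewrite updC// ih.
Qed.

Lemma lavgs_agree s psi y y' : (forall i, i \notin s -> y i = y' i) ->
  lavgs s psi y = lavgs s psi y'.
Proof.
elim: s y y' => [|g s ih] y y' h /=.
  by congr psi; apply/ffunP => i; apply: h.
rewrite /lavg; congr (ln (_ / _)); apply: eq_bigr => u _; congr expR.
apply: ih => i si; rewrite !ffunE; case: eqP => // /eqP ig.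
by apply: h; rewrite inE negb_or ig.
Qed.

(** Swapping the letter at [g] with a spare letter is an involution on pairs (word, letter), so the
    double sum counts each word once for each spare letter. *)
Lemma sum_upd g (f : {ffun I -> Sg} -> R) :
  \sum_y \sum_s f (upd y g s) = #|Sg|%:R * \sum_y f y.
Proof.
rewrite pair_bigA/=.
pose h (p : {ffun I -> Sg} * Sg) := (upd p.1 g p.2, p.1 g).
have hK : involutive h.
  move=> [y s]; rewrite /h /= updK; congr pair; last by rewrite ffunE eqxx.
  by apply/ffunP => i; rewrite ffunE; case: eqP => [->|].
transitivity (\sum_(p : {ffun I -> Sg} * Sg) f p.1).
  by rewrite [RHS](reindex_inj (inv_inj hK)).
rewrite -(pair_bigA _ (fun y _ => f y))/= mulr_sumr.
by apply: eq_bigr => y _; rewrite sumr_const mulr_natl.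
Qed.

Lemma sum_expR_lavgs s psi :
  \sum_y expR (lavgs s psi y) = \sum_y expR (psi y).
Proof.
elim: s => [//|g s <-] /=.
under eq_bigr do rewrite expR_lavg.
by rewrite -mulr_suml (sum_upd g (fun y => expR (lavgs s psi y))) mulrAC divff ?mul1r// gt_eqF.
Qed.

Lemma expR_lavgs_enum psi y :
  expR (lavgs (enum I) psi y) = (\sum_z expR (psi z)) / #|{ffun I -> Sg}|%:R.
Proof.
rewrite -(sum_expR_lavgs (enum I)).
under eq_bigr => z _.
  rewrite (@lavgs_agree _ _ _ y) => [|i]; last by rewrite mem_enum.
  over.
rewrite sumr_const -[X in X / _]mulr_natr mulfK//.
by rewrite pnatr_eq0 -lt0n; apply/card_gt0P; exists y.
Qed.

Variables (r : nat) (S : J -> {set I}).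
Hypotheses (r0 : (0 < r)%N)
  (Sr : forall i, (#|[pred j | i \in S j]| <= r)%N).

(** Hoelder's inequality in one coordinate. Each factor is normalised by its own average [c j];
    factors that do not depend on [g] then become [1], and AM-GM for the others, of which there are
    at most [r], closes the estimate after averaging over [s]. *)
Lemma lavg_holder (psi : J -> {ffun I -> Sg} -> R) g y :
  (forall j, g \notin S j -> indep g (psi j)) ->
  lavg g (fun z => \sum_j psi j z / r%:R) y <=
    \sum_j lavg g (psi j) y / r%:R.
Proof.
move=> h; set c := fun j => lavg g (psi j) y.
have r0R : 0 < r%:R :> R by rewrite ltr0n.
set A := [pred j | g \in S j].
rewrite -ler_expR expR_lavg ler_pdivrMr//.
have cind j s : j \notin A -> psi j (upd y g s) = c j.
  move=> /= Aj; rewrite (h j Aj) /c /lavg.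
  under eq_bigr do rewrite (h j Aj).
  by rewrite sumr_const -[X in X / _]mulr_natr mulfK ?gt_eqF// expRK.
have csum j : \sum_s expR (psi j (upd y g s) - c j) = #|Sg|%:R.
  under eq_bigr do rewrite expRD expRN.
  rewrite -mulr_suml expR_lavg.
  by field; rewrite !gt_eqF//= sum_expR_gt0.
have -> : \sum_s expR (\sum_j psi j (upd y g s) / r%:R) =
    expR (\sum_j c j / r%:R) *
    \sum_s expR (\sum_(j in A) (psi j (upd y g s) - c j) / r%:R).
  rewrite mulr_sumr; apply: eq_bigr => s _; rewrite -expRD; congr expR.
  rewrite (big_mkcond (mem A))/= -big_split/=; apply: eq_bigr => j _.
  case: ifPn => Aj; first by ring.
  by rewrite cind// addr0.
rewrite ler_pM2l ?expR_gt0//.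
apply: (le_trans (ler_sum _ (fun s _ => expR_weighted_AGM _ r0 (Sr g)))).
rewrite big_split/= exchange_big/= sumr_const.
under eq_bigr do rewrite -mulr_suml csum.
rewrite sumr_const -[X in X + _]mulr_natr -[X in _ + X]mulr_natr.
by rewrite le_eqVlt; apply/orP; left; apply/eqP; field; rewrite gt_eqF.
Qed.

Lemma lavgs_holder (psi : J -> {ffun I -> Sg} -> R) s y :
  (forall j g, g \notin S j -> indep g (psi j)) ->
  lavgs s (fun z => \sum_j psi j z / r%:R) y <=
    \sum_j lavgs s (psi j) y / r%:R.
Proof.
move=> h; elim: s y => [//|g s ih] y /=.
apply: (le_trans (le_lavg g ih y)).
apply: (@lavg_holder (fun j => lavgs s (psi j))) => j gj.
exact/indep_lavgs/h.
Qed.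

(** The one-coordinate inequality is iterated over all of [I], after which the averaged functions
    are constant. In multiplicative form, with [f_j = expR psi_j] depending only on [S j], the mean
    of [prod_j f_j^(1/r)] is at most [prod_j (mean f_j)^(1/r)]. *)
Lemma finner (psi : J -> {ffun I -> Sg} -> R) :
  (forall j g, g \notin S j -> indep g (psi j)) ->
  (\sum_y expR (\sum_j psi j y / r%:R)) / #|{ffun I -> Sg}|%:R <=
  expR (\sum_j ln ((\sum_y expR (psi j y)) / #|{ffun I -> Sg}|%:R) / r%:R).
Proof.
move=> h; have /card_gt0P[s0 _] := Sg0.
rewrite -(@expR_lavgs_enum _ [ffun=> s0]) ler_expR.
apply: (le_trans (lavgs_holder (enum I) _ h)).
by apply: ler_sum => j _; rewrite -(@expR_lavgs_enum _ [ffun=> s0]) expRK.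
Qed.

End Finner.

(** * Fractional covering by the tiles of a tempered sequence *)

Section CountFset.
Variables (G : groupType) (R : realType).
Implicit Types (A B D K L W : {fset G}) (a b g u : G).

Lemma mem_frmul A g x : (x \in frmul A g) = ((x * g^-1)%g \in A).
Proof.
apply/imfsetP/idP => [[a /= aA ->]|xA]; first by rewrite mulgK.
by exists (x * g^-1)%g => //; rewrite mulgVK.
Qed.

Lemma mem_flmul g A x : (x \in flmul g A) = ((g^-1 * x)%g \in A).
Proof.
apply/imfsetP/idP => [[a /= aA ->]|xA]; first by rewrite mulKg.
by exists (g^-1 * x)%g => //; rewrite mulVKg.
Qed.

Lemma fdisjointPn A B :
  reflect (exists2 g, g \in A & g \in B) (~~ [disjoint A & B]%fset).
Proof.
rewrite -fsetI_eq0; apply: (iffP (fset0Pn _)) => [[g]|[g gA gB]].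
  by rewrite in_fsetI => /andP[]; exists g.
by exists g; rewrite in_fsetI gA.
Qed.

Lemma card_frmul A g : #|` frmul A g| = #|` A|.
Proof. by rewrite card_imfset//; exact: mulIg. Qed.

Lemma sumr_const_seq_le (T : eqType) (s t : seq T) (P : pred T) (f : T -> R) (c : R) :
  uniq s -> 0 <= c -> (forall x, x \in s -> P x -> f x <= c) ->
  (forall x, x \in s -> P x -> x \in t) ->
  \sum_(x <- s | P x) f x <= c * (size t)%:R.
Proof.
move=> us c0 fc st.
apply: (@le_trans _ _ (\sum_(x <- s | P x) c)).
  by rewrite big_seq_cond [leRHS]big_seq_cond; apply: ler_sum => x /andP[/fc].
rewrite big_const_seq iter_addr addr0 -[leLHS]mulr_natr ler_wpM2l// ler_nat.
rewrite -size_filter uniq_leq_size ?filter_uniq// => x.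
by rewrite mem_filter => /andP[Px xs]; apply: st.
Qed.

End CountFset.

Section TemperedWeights.
Variables (G : groupType) (R : realType) (F : nat -> {fset G}).
Variables (A : {fset G}) (nu : G -> nat).
Hypothesis F0 : forall a, a \in A -> F (nu a) != fset0.
Implicit Types (p : G -> R) (a b g : G).

Let tile a := frmul (F (nu a)) a.
Let hits a b := ~~ [disjoint tile a & tile b]%fset.

Let hitsP a b g : g \in tile a -> g \in tile b -> hits a b.
Proof. by move=> ga gb; apply/fdisjointPn; exists g. Qed.

(* The tiles of level [>= n] are already weighted.  On level [n], a tile gets
   the weight [1 / |F n|] multiplied by the fraction left over by the tiles of
   higher level that meet it; as a point lies in at most [|F n|] tiles of level
   [n], the total weight over a point stays at most [1]. *)
Lemma tempered_weights_level (N n k : nat) : (forall a, a \in A -> (nu a <= N)%N) ->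
  (n + k = N.+1)%N ->
  exists p, [/\ forall a, 0 <= p a,
    forall b, (nu b < n)%N -> p b = 0,
    forall g, \sum_(b <- A | g \in tile b) p b <= 1 &
    forall a, a \in A -> (n <= nu a)%N ->
      1 <= p a * #|` F (nu a)|%:R +
           \sum_(b <- A | (nu a < nu b)%N && hits a b) p b].
Proof.
move=> AN; elim: k n => [|k ih] n nk.
  exists (fun=> 0); split => // [g|a /AN aN na].
    by rewrite big1// ler01.
  by move: nk; rewrite addn0 => nN; move: na; rewrite nN ltnNge aN.
have [|p [p0 pn p1 pA]] := ih n.+1; first by rewrite addSn -addnS.
pose q a := \sum_(b <- A | (nu a < nu b)%N && hits a b) p b.
pose p' a := if nu a == n then Num.max 0 (1 - q a) / #|` F n|%:R else p a.
have q' a : (n <= nu a)%N ->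
    \sum_(b <- A | (nu a < nu b)%N && hits a b) p' b = q a.
  move=> na; apply: eq_bigr => b /andP[ab _].
  by rewrite /p' gtn_eqF// (leq_ltn_trans na).
exists p'; split.
- move=> a; rewrite /p'; case: ifP => // _.
  by rewrite mulr_ge0// ?invr_ge0// le_max lexx.
- move=> b bn; rewrite /p' ltn_eqF// pn//.
  exact: leqW.
- move=> g; rewrite (bigID (fun b => nu b == n))/=.
  set La := \sum_(b <- A | g \in tile b) p b.
  have -> : \sum_(b <- A | (g \in tile b) && (nu b != n)) p' b = La.
    rewrite /La [RHS](bigID (fun b => nu b == n))/= [X in _ = X + _]big1 ?add0r; last first.
      by move=> b /andP[_ /eqP bn]; rewrite pn// bn.
    by apply: eq_bigr => b /andP[_ /negbTE bn]; rewrite /p' bn.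
  have [F0n|F0n] := eqVneq (F n) fset0.
    rewrite big_seq_cond big_pred0 ?add0r ?p1// => a.
    apply/negbTE/negP => /and3P[aA _ /eqP an].
    by have := F0 aA; rewrite an F0n eqxx.
  have Fn0 : 0 < #|` F n|%:R :> R by rewrite ltr0n cardfs_gt0.
  (* Every higher tile over [g] meets each level-[n] tile over [g], so the latter weigh at most
     [max(0, 1 - La) / |F n|] each; their centres lie in [(F n)^-1 g], hence there are at most
     [|F n|] of them. *)
  have : \sum_(b <- A | (g \in tile b) && (nu b == n)) p' b <=
      Num.max 0 (1 - La) / #|` F n|%:R * (size [seq (u^-1 * g)%g | u <- F n])%:R.
    apply: sumr_const_seq_le.
    - exact: fset_uniq.
    - by rewrite mulr_ge0// ?invr_ge0// le_max lexx.
    - move=> a aA /andP[ga /eqP an]; rewrite /p' an eqxx.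
      rewrite ler_pM2r ?invr_gt0// ge_max le_max lexx/= le_max lerD2l lerN2.
      apply/orP; right; rewrite /La /q an.
      rewrite [leLHS](bigID (fun b => (n < nu b)%N))/= [X in _ + X <= _]big1 ?addr0; last first.
        by move=> b /andP[_]; rewrite -leqNgt => bn; rewrite pn.
      rewrite [leRHS](bigID (fun b => g \in tile b))/= -[leLHS]addr0 lerD//.
        rewrite [leRHS]big_mkcond/= [leLHS]big_mkcond/= ler_sum// => b _.
        case: ifP => [/andP[gb nb]|_]; last by case: ifP.
        by rewrite nb gb (hitsP ga gb).
      by rewrite sumr_ge0.
    - move=> a aA /andP[]; rewrite mem_frmul => ga /eqP an.
      rewrite an in ga; apply/mapP; exists (g * a^-1)%g => //.
      by rewrite invgM invgK mulgVK.
  rewrite size_map mulfVK ?gt_eqF// => le1.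
  apply: le_trans (lerD le1 (lexx _)) _.
  by have := p1 g; rewrite -/La; case: (leP 0 (1 - La)); lra.
- move=> a aA na; rewrite q'// /p'; case: eqP => [an|/eqP an].
    have Fn0 : 0 < #|` F n|%:R :> R by rewrite ltr0n cardfs_gt0 -an F0.
    rewrite an mulfVK ?gt_eqF// -lerBlDr.
    by rewrite le_max lexx orbT.
  by apply: pA => //; rewrite ltn_neqAle eq_sym an.
Qed.

Variable C : R.
Hypothesis temper : forall n, (1 <= n)%N ->
  #|` Defs.fprod (fbigcup_lt (fun k => finvs (F k)) n) (F n)|%:R <= C * #|` F n|%:R.
Hypothesis nu0 : forall a, a \in A -> (1 <= nu a)%N.

(** The level estimates are summed over [a] and the double sum is exchanged, so that a tile of
    centre [b] is charged by the lower tiles meeting it. Their centres satisfy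
    [a b^-1 \in F_(nu a)^-1 F_(nu b)] with [nu a < nu b], and temperedness leaves at most
    [C |F_(nu b)|] of them. *)
Lemma tempered_weights : exists p, [/\ forall a, 0 <= p a,
    forall g, \sum_(b <- A | g \in tile b) p b <= 1 &
    #|` A|%:R <= (1 + C) * \sum_(a <- A) p a * #|` F (nu a)|%:R].
Proof.
have [|p [p0 _ p1 pA]] :=
  @tempered_weights_level (\max_(a <- A) nu a) 0 (\max_(a <- A) nu a).+1 _ (add0n _).
  by move=> a aA; rewrite leq_bigmax_seq.
exists p; split=> //.
rewrite -sum1_size natr_sum mulrDl mul1r.
apply: (@le_trans _ _ (\sum_(a <- A) (p a * #|` F (nu a)|%:R +
   \sum_(b <- A | (nu a < nu b)%N && hits a b) p b))).
  by rewrite big_seq [leRHS]big_seq; apply: ler_sum => a aA; rewrite pA.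
rewrite big_split/= lerD2l mulr_sumr.
rewrite (exchange_big_dep xpredT)//= big_seq [leRHS]big_seq.
apply: ler_sum => b bA; rewrite mulrCA.
have h := @sumr_const_seq_le R G A
  [seq (c * b)%g | c <- Defs.fprod (fbigcup_lt (fun k => finvs (F k)) (nu b)) (F (nu b))]
  (fun a => (nu a < nu b)%N && hits a b) (fun=> p b) (p b) (fset_uniq _) (p0 b).
apply: le_trans (h _ _) _ => //.
  move=> a aA /andP[ab /fdisjointPn[g]].
  rewrite !mem_frmul => ga gb; apply/mapP.
  exists (a * b^-1)%g; last by rewrite mulgVK.
  apply/imfset2P; exists (a * g^-1)%g => /=.
    apply/bigfcupP; exists (nu a).
      by rewrite mem_index_iota nu0//= ab.
    apply/imfsetP; exists (g * a^-1)%g => //=.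
    by rewrite invgM invgK.
  by exists (g * b^-1)%g => //=; rewrite mulgA mulgVK.
by rewrite size_map ler_wpM2l// temper// nu0.
Qed.

(** Finite form of the weak (1,1) inequality: [A] collects centres whose tile has [phi]-average at
    least [la]. Weighting the tiles by [p] replaces the choice of a disjoint subfamily; as the
    weights over a point add up to at most [1], the sum of [phi] over [B] dominates. *)
Lemma tempered_maximal_count (la : R) (phi : G -> R) (B : {fset G}) :
  0 <= C -> 0 <= la -> (forall g, 0 <= phi g) ->
  (forall a u, a \in A -> u \in F (nu a) -> (u * a)%g \in B) ->
  (forall a, a \in A ->
     la * #|` F (nu a)|%:R <= \sum_(u <- F (nu a)) phi (u * a)%g) ->
  la * #|` A|%:R <= (1 + C) * \sum_(g <- B) phi g.
Proof.
move=> C0 la0 phi0 AB laA; have [p [p0 p1 pA]] := tempered_weights.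
apply: le_trans (ler_wpM2l la0 pA) _; rewrite mulrCA ler_wpM2l ?addr_ge0//.
rewrite mulr_sumr.
apply: (@le_trans _ _ (\sum_(a <- A) \sum_(g <- B | g \in tile a) p a * phi g)).
  rewrite big_seq [leRHS]big_seq; apply: ler_sum => a aA.
  rewrite mulrCA -mulr_sumr ler_wpM2l//.
  apply: le_trans (laA a aA) _.
  have -> : \sum_(u <- F (nu a)) phi (u * a)%g = \sum_(g <- tile a) phi g.
    by rewrite big_imfset//= => u v _ _; apply: mulIg.
  rewrite -[leRHS]big_filter (perm_big [seq g <- B | g \in tile a])//.
  apply: uniq_perm; rewrite ?filter_uniq ?fset_uniq// => g.
  rewrite mem_filter; apply/idP/andP => [ga|[]//]; split=> //.
  by case/imfsetP: ga => u /= uF ->; apply: AB.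
rewrite (exchange_big_dep xpredT)//=; apply: ler_sum => g _.
by rewrite -mulr_suml ler_piMl.
Qed.

End TemperedWeights.

(** * Invariance along a Foelner sequence *)

Section Folner.
Variables (G : groupType) (R : realType) (F : nat -> {fset G}).
Implicit Types (D K : {fset G}) (g f : G) (k : nat).

Definition lsdiff g (L : {fset G}) : {fset G} :=
  ((L `\` flmul g L) `|` (flmul g L `\` L))%fset.

Lemma card_flmul g (L : {fset G}) : #|` flmul g L| = #|` L|.
Proof. by rewrite card_imfset//; exact: mulgI. Qed.

Lemma card_bigfcup_le (T : eqType) (s : seq T) (A : T -> {fset G}) :
  (#|` \big[fsetU/fset0]_(i <- s) A i| <= \sum_(i <- s) #|` A i|)%N.
Proof.
elim/big_rec2: _ => [|i m B _ h]; first by rewrite cardfs0.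
by apply: leq_trans (leq_card_fsetU _ _) _; rewrite leq_add2l.
Qed.

Lemma card_fprod_le D (L : {fset G}) :
  (#|` Defs.fprod D L| <= #|` L| + \sum_(g <- D) #|` lsdiff g L|)%N.
Proof.
apply: (@leq_trans #|` (L `|` \big[fsetU/fset0]_(g <- D) lsdiff g L)%fset|).
  apply/fsubset_leq_card/fsubsetP => x /imfset2P[g /= gD [f /= fL ->]].
  rewrite in_fsetU; case: (boolP (_ \in L)) => //= gf.
  apply/bigfcupP; exists g; first by rewrite gD.
  by rewrite in_fsetU !in_fsetD gf mem_flmul mulKg fL orbT.
apply: leq_trans (leq_card_fsetU _ _) _.
by rewrite leq_add2l card_bigfcup_le.
Qed.

Definition boundary K (L : {fset G}) : {fset G} :=
  [fset f in L | has (fun g => (g * f)%g \notin L) K]%fset.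

Lemma card_boundary_le K (L : {fset G}) :
  (#|` boundary K L| <= \sum_(g <- K) #|` lsdiff g L|)%N.
Proof.
apply: (@leq_trans (\sum_(g <- K) #|` flmul g^-1 (flmul g L `\` L)%fset|)).
  apply: leq_trans (card_bigfcup_le _ _).
  apply/fsubset_leq_card/fsubsetP => f; rewrite !inE/= => /andP[fL /hasP[g gK gf]].
  apply/bigfcupP; exists g; first by rewrite gK.
  by rewrite mem_flmul invgK in_fsetD gf mem_flmul mulKg.
apply: leq_sum => g _; rewrite card_flmul fsubset_leq_card//.
exact: fsubsetUr.
Qed.

(** The sums over [L] and [gL] cancel on the intersection; only the symmetric difference
    survives. *)
Lemma sum_flmul_le g (L : {fset G}) (u : G -> R) (M : R) :
  (forall x, `|u x| <= M) ->
  `|\sum_(a <- L) (u a - u (g * a)%g)| <= M * #|` lsdiff g L|%:R.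
Proof.
move=> uM; have M0 : 0 <= M by apply: le_trans (uM 1%g).
rewrite sumrB.
have -> : \sum_(a <- L) u (g * a)%g = \sum_(a <- flmul g L) u a.
  by rewrite big_imfset//= => x y _ _; apply: mulgI.
rewrite (big_fsetID _ (mem (flmul g L)) L)/=.
rewrite [X in _ - X](big_fsetID _ (mem L))/=.
set a := \sum_(i <- _) _; set b := \sum_(i <- _) _; set c := \sum_(i <- _) _.
have -> : c = a by apply: eq_fbigl => x; rewrite !inE/= andbC.
rewrite opprD addrACA subrr add0r.
set d := \sum_(i <- _) _.
apply: le_trans (ler_normB _ _) _.
have bnd (A : {fset G}) : `|\sum_(i <- A) u i| <= M * #|` A|%:R.
  apply: le_trans (ler_norm_sum _ _ _) _.
  by apply: (@sumr_const_seq_le R G A A xpredT) => //; exact: fset_uniq.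
apply: le_trans (lerD (bnd _) (bnd _)) _.
rewrite -mulrDr -natrD ler_wpM2l// ler_nat /lsdiff cardfsU.
have -> : ((L `\` flmul g L) `&` (flmul g L `\` L) = fset0)%fset.
  by apply/fsetP => x; rewrite !inE; case: (x \in L); rewrite ?andbF.
rewrite cardfs0 subn0 leq_add// fsubset_leq_card//.
  by apply/fsubsetP => x; rewrite !inE/= andbC.
by apply/fsubsetP => x; rewrite !inE/= andbC.
Qed.

Hypothesis folner : forall g,
  (fun n => #|` lsdiff g (F n)|%:R / (#|` F n|)%:R : R) @ \oo --> (0 : R).
Hypothesis F0 : forall k, (k <= #|` F k|)%N.

Lemma folner_sum D (eps : R) : 0 < eps ->
  \forall k \near \oo,
    (\sum_(g <- D) #|` lsdiff g (F k)|)%:R <= eps * #|` F k|%:R.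
Proof.
move=> e0.
have h : (fun n => \sum_(g <- D) (#|` lsdiff g (F n)|%:R / (#|` F n|)%:R : R)) @ \oo --> (0 : R).
  elim: (enum_fset D) => [|g s ih].
    by under eq_fun do rewrite big_nil; exact: cvg_cst.
  under eq_fun do rewrite big_cons.
  by have := cvgD (folner g) ih; rewrite addr0; apply.
near=> k.
have k0 : 0 < #|` F k|%:R :> R.
  by rewrite ltr0n; apply: leq_trans (F0 k); near: k; exists 1%N.
rewrite -ler_pdivrMr// natr_sum mulr_suml; near: k.
have := cvgr_le _ h eps e0; apply.
Unshelve. all: by end_near. Qed.

Lemma folner_fprod D : \forall k \near \oo,
  #|` Defs.fprod D (F k)|%:R <= 2 * #|` F k|%:R :> R.
Proof.
have := @folner_sum D 1 ltr01; apply: filterS => k h.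
rewrite (le_trans (y := (#|` F k| + \sum_(g <- D) #|` lsdiff g (F k)|)%:R))//.
  by rewrite ler_nat card_fprod_le.
by rewrite natrD; lra.
Qed.

Lemma folner_boundary K (eps : R) : 0 < eps ->
  \forall k \near \oo, #|` boundary K (F k)|%:R <= eps * #|` F k|%:R :> R.
Proof.
move=> e0; have := @folner_sum K eps e0; apply: filterS => k.
by apply: le_trans; rewrite ler_nat card_boundary_le.
Qed.

End Folner.

(** * Bounded measurable functions *)

Section BoundedMeasurable.
Context (d : measure_display) (T : measurableType d) (R : realType).
Variable P : probability T R.
Implicit Types (f g : T -> R) (A B : set T).

Definition bdm f := measurable_fun setT f /\ exists M, forall x, `|f x| <= M.

Definition mean f : R := \int[P]_x f x.

Lemma bdm_integrable f : bdm f -> P.-integrable setT (EFin \o f).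
Proof.
move=> [mf [M fM]]; apply: measurable_bounded_integrable => //.
  by rewrite [X in (X < _)%E]probability_setT ltry.
exists M; split; first exact: num_real.
by move=> t Mt x _; exact: le_trans (fM x) (ltW Mt).
Qed.

Lemma bdm_cst (c : R) : bdm (fun=> c).
Proof. by split; [exact: measurable_cst|exists `|c|]. Qed.

Lemma bdmD f g : bdm f -> bdm g -> bdm (fun x => f x + g x).
Proof.
move=> [mf [M fM]] [mg [N gN]]; split; first exact: measurable_funD.
by exists (M + N) => x; apply: le_trans (ler_normD _ _) _; exact: lerD.
Qed.

Lemma bdmM f g : bdm f -> bdm g -> bdm (fun x => f x * g x).
Proof.
move=> [mf [M fM]] [mg [N gN]]; split; first exact: measurable_funM.
by exists (M * N) => x; rewrite normrM ler_pM.
Qed.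

Lemma bdmZ (c : R) f : bdm f -> bdm (fun x => c * f x).
Proof. by move=> bf; apply: bdmM bf; exact: bdm_cst. Qed.

Lemma bdmN f : bdm f -> bdm (fun x => - f x).
Proof.
by move=> bf; under eq_fun do rewrite -mulN1r; exact: bdmZ.
Qed.

Lemma bdmB f g : bdm f -> bdm g -> bdm (fun x => f x - g x).
Proof. by move=> bf bg; apply: bdmD bf _; exact: bdmN. Qed.

Lemma bdm_norm f : bdm f -> bdm (fun x => `|f x|).
Proof.
move=> [mf [M fM]]; split; first exact: measurableT_comp.
by exists M => x; rewrite normr_id.
Qed.

Lemma bdm_sum (I : Type) (s : seq I) (Q : pred I) (f : I -> T -> R) :
  (forall i, bdm (f i)) -> bdm (fun x => \sum_(i <- s | Q i) f i x).
Proof.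
move=> bf; elim: s => [|i s ih].
  by under eq_fun do rewrite big_nil; exact: bdm_cst.
under eq_fun do rewrite big_cons.
by case: (Q i) => //; exact: bdmD.
Qed.

Lemma bdm_comp (phi : T -> T) f :
  measurable_fun setT phi -> bdm f -> bdm (f \o phi).
Proof.
move=> mphi [mf [M fM]]; split; first exact: measurableT_comp.
by exists M => x; exact: fM.
Qed.

Lemma bdm_indic A : measurable A -> bdm \1_A.
Proof.
move=> mA; split; first exact: measurable_indic.
by exists 1 => x; rewrite indicE; case: (_ \in _); rewrite ?normr0 ?normr1 ?ler01.
Qed.

Lemma mean_cst (c : R) : mean (fun=> c) = c.
Proof.
transitivity (c * fine (P setT)); first exact: Rintegral_cst.
by rewrite probability_setT/= mulr1.
Qed.

Lemma meanD f g : bdm f -> bdm g -> mean (fun x => f x + g x) = mean f + mean g.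
Proof. by move=> bf bg; apply: RintegralD => //; exact: bdm_integrable. Qed.

Lemma meanB f g : bdm f -> bdm g -> mean (fun x => f x - g x) = mean f - mean g.
Proof. by move=> bf bg; apply: RintegralB => //; exact: bdm_integrable. Qed.

Lemma meanZ (c : R) f : bdm f -> mean (fun x => c * f x) = c * mean f.
Proof. by move=> bf; apply: RintegralZl => //; exact: bdm_integrable. Qed.

Lemma mean_sum (I : Type) (s : seq I) (Q : pred I) (f : I -> T -> R) :
  (forall i, bdm (f i)) ->
  mean (fun x => \sum_(i <- s | Q i) f i x) = \sum_(i <- s | Q i) mean (f i).
Proof.
move=> bf; elim: s => [|i s ih].
  by under [X in mean X]eq_fun do rewrite big_nil; rewrite big_nil mean_cst.
under [X in mean X]eq_fun do rewrite big_cons; rewrite big_cons.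
by case: (Q i) => //; rewrite meanD ?ih//; exact: bdm_sum.
Qed.

Lemma le_mean f g : bdm f -> bdm g -> (forall x, f x <= g x) -> mean f <= mean g.
Proof. by move=> bf bg fg; apply: le_Rintegral => //; exact: bdm_integrable. Qed.

Lemma mean_ge0 f : (forall x, 0 <= f x) -> 0 <= mean f.
Proof. by move=> f0; exact: Rintegral_ge0. Qed.

Lemma mean_indic A : measurable A -> mean \1_A = fine (P A).
Proof. by move=> mA; rewrite /mean /Rintegral integral_indic// setIT. Qed.

Lemma mean_comp (phi : T -> T) f : measurable_fun setT phi ->
  (forall A, measurable A -> P (phi @^-1` A) = P A) ->
  bdm f -> mean (f \o phi) = mean f.
Proof.
move=> mphi hphi bf; rewrite /mean /Rintegral; congr fine.
have bfp := bdm_comp mphi bf.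
transitivity (\int[pushforward P phi]_y (f y)%:E)%E.
  rewrite integral_pushforward ?preimage_setT//; first last.
    exact: bdm_integrable.
  by apply/measurable_EFinP; case: bf.
by apply: eq_measure_integral => A mA _; exact: hphi.
Qed.

Lemma fine_prob A : measurable A -> (fine (P A))%:E = P A.
Proof. by move=> mA; rewrite fineK// fin_num_measure. Qed.

Lemma prob_markov f (c : R) : bdm f -> (forall x, 0 <= f x) ->
  c * fine (P [set x | c <= f x]) <= mean f.
Proof.
move=> bf f0.
have mA : measurable [set x | c <= f x].
  rewrite -[X in measurable X]setTI; apply: measurable_fun_le => //.
  by case: bf.
have [c0|c0] := leP c 0.
  by apply: le_trans (mean_ge0 f0); rewrite mulr_le0_ge0// fine_ge0.
rewrite -mean_indic// -meanZ; last exact: bdm_indic.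
apply: le_mean => //; first exact/bdmZ/bdm_indic.
move=> x; rewrite indicE; case: (boolP (x \in _)) => [|_].
  by rewrite inE mulr1.
by rewrite mulr0.
Qed.

End BoundedMeasurable.

(** * The mean ergodic theorem *)

Lemma measurable_lim_sup_set (d : measure_display) (T : measurableType d)
  (A : (set T)^nat) : (forall j, measurable (A j)) -> measurable (lim_sup_set A).
Proof.
move=> mA; apply: bigcap_measurable => // n _.
exact: bigcup_measurable.
Qed.

Lemma lim_sup_setPn (T : Type) (A : (set T)^nat) x :
  ~ lim_sup_set A x -> \forall j \near \oo, ~ A j x.
Proof.
move=> nA; apply: contrapT => h; apply: nA => n _; apply: contrapT => hn.
by apply: h; exists n => // j /= nj Aj; apply: hn; exists j.
Qed.

Lemma countable_enum (G : groupType) : countable_group G ->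
  exists e : nat -> G, forall g, exists n, e n = g.
Proof.
move=> [f injf].
exists (fun n => if pselect (exists g, f g = n) is left h then projT1 (cid h) else 1%g).
move=> g; exists (f g); case: pselect => [h|[]]; last by exists g.
by apply: injf; case: cid.
Qed.

Lemma half_expn_le (R : realType) (eps : R) : 0 < eps ->
  \forall j \near \oo, (2^-1 : R) ^+ j <= eps.
Proof.
move=> e0; have : (fun n => (2^-1 : R) ^+ n) @ \oo --> (0 : R).
  by apply: cvg_expr; rewrite ger0_norm ?invr_ge0// invf_lt1// ltr1n.
by move/cvgr_le; apply.
Qed.

Lemma borel_cantelli_half (d : measure_display) (T : measurableType d)
  (R : realType) (P : probability T R) (A : (set T)^nat) :
  (forall j, measurable (A j)) -> (forall j, fine (P (A j)) <= (2^-1) ^+ j) ->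
  P (lim_sup_set A) = 0%E.
Proof.
move=> mA PA; apply: lim_sup_set_cvg0 => //.
have h := @cvg_geometric_eseries_half R 2 0.
apply: (@le_lt_trans _ _ (\sum_(n <oo) (2 / (2 ^ (n + 1))%:R)%:E)%E).
  apply: lee_nneseries => // n _; rewrite -[leLHS](fine_prob P (mA n)) lee_fin.
  apply: le_trans (PA n) _.
  by rewrite addn1 natrX exprS invfM mulVKf// exprVn.
by rewrite (cvg_lim _ h)// ltry.
Qed.

Lemma lim_sup_set_negligible (d : measure_display) (T : measurableType d)
  (R : realType) (P : probability T R) (A : (set T)^nat) (t : R) :
  (forall j, measurable (A j)) -> P.-negligible (lim_sup_set A) -> 0 < t ->
  exists n, fine (P (A n)) <= t.
Proof.
move=> mA negA t0.
have PA : P (lim_sup_set A) = 0%E.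
  by apply/negligibleP => //; exact: measurable_lim_sup_set.
have h : fine \o (fun n => P (\bigcup_(k >= n) A k)) @ \oo --> (0 : R).
  apply: fine_cvg; rewrite -[0%:E]PA; apply: lim_sup_set_cvg => //.
  apply: le_lt_trans (ltry 1); apply: probability_le1.
  exact: bigcup_measurable.
have [n _ /(_ n (leqnn n))/= hn] := cvgr_le _ h _ t0.
exists n; apply: le_trans hn.
have mU : measurable (\bigcup_(k >= n) A k) by exact: bigcup_measurable.
rewrite fine_le ?fin_num_measure// le_measure ?inE//.
by move=> x Ax; exists n => /=.
Qed.

Section MeanErgodic.
Variables (G : groupType) (R : realType) (d : measure_display) (T : measurableType d).
Variables (P : probability T R) (act : G -> T -> T).
Hypotheses (cG : countable_group G) (mp : mp_action P act)
  (erg : ergodic_action P act).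

Let act1 x : act 1%g x = x. Proof. by case: mp. Qed.
Let actM g g' x : act (g * g')%g x = act g (act g' x).
Proof. by case: mp => _ []. Qed.
Let mact g : measurable_fun setT (act g). Proof. by case: mp => _ [_ []]. Qed.

Lemma bdm_act g (u : T -> R) : bdm u -> bdm (fun x => u (act g x)).
Proof. exact: bdm_comp. Qed.

Lemma mean_act g (u : T -> R) : bdm u -> mean P (fun x => u (act g x)) = mean P u.
Proof.
by move=> bu; apply: mean_comp => // A mA; case: mp => _ [_ [_]]; apply.
Qed.

(** Dyadic convex hull of the translates of [f]. Midpoints suffice for the parallelogram law, and
    the inductive form lets bounds, means and orbit averages be transported by induction. *)
Inductive hull (f : T -> R) : (T -> R) -> Prop :=
| hull_id : hull f f
| hull_act g u : hull f u -> hull f (fun x => u (act g x))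
| hull_mid u v : hull f u -> hull f v -> hull f (fun x => 2^-1 * (u x + v x)).

Variables (f : T -> R) (M : R).
Hypotheses (mf : measurable_fun setT f) (fM : forall x, `|f x| <= M).

Let bf : bdm f. Proof. by split=> //; exists M. Qed.

Lemma hull_bdm u : hull f u -> bdm u.
Proof.
elim=> // [g v _|v w _ bv _ bw]; first exact: bdm_act.
exact/bdmZ/bdmD.
Qed.

Lemma hull_bound u : hull f u -> forall x, `|u x| <= M.
Proof.
elim=> // v w _ bv _ bw x.
rewrite normrM ger0_norm ?invr_ge0// mulrC ler_pdivrMr//.
apply: le_trans (ler_normD _ _) _; rewrite mulr_natr mulr2n.
exact: lerD.
Qed.

Lemma hull_mean u : hull f u -> mean P u = mean P f.
Proof.
elim=> // [g v /hull_bdm bv <-|v w /hull_bdm bv ev /hull_bdm bw ew].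
  exact: mean_act.
by rewrite meanZ ?meanD ?ev ?ew//; [field|exact: bdmD].
Qed.

Let energy (u : T -> R) := mean P (fun x => u x * u x).
Let dmin := inf [set energy u | u in hull f].

Let has_inf_energy : has_inf [set energy u | u in hull f].
Proof.
split; first by exists (energy f), f => //; exact: hull_id.
by exists 0 => _ [u _ <-]; apply: mean_ge0 => x; rewrite -expr2 sqr_ge0.
Qed.

Let energy_ge u : hull f u -> dmin <= energy u.
Proof.
by move=> hu; apply: ge_inf; [case: has_inf_energy|exists u].
Qed.

(* Parallelogram law: the midpoint of [u] and [v] cannot beat [dmin]. *)
Lemma hull_close (u v : T -> R) (eta : R) : hull f u -> hull f v ->
  energy u <= dmin + eta -> energy v <= dmin + eta ->
  mean P (fun x => (u x - v x) * (u x - v x)) <= 4 * eta.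
Proof.
move=> hu hv eu ev; have bu := hull_bdm hu; have bv := hull_bdm hv.
set w := fun x => 2^-1 * (u x + v x).
have hw : hull f w by exact: hull_mid.
have bw := hull_bdm hw.
have -> : (fun x => (u x - v x) * (u x - v x)) =
  (fun x => (2 * (u x * u x) + 2 * (v x * v x)) - 4 * (w x * w x)).
  by apply/funext => x; rewrite /w; field.
have bu2 := bdmM bu bu; have bv2 := bdmM bv bv; have bw2 := bdmM bw bw.
rewrite meanB; [|by apply: bdmD; exact: bdmZ|exact: bdmZ].
rewrite meanD; [|exact: bdmZ|exact: bdmZ]; rewrite !meanZ//.
by have := energy_ge hw; rewrite /energy in eu ev *; lra.
Qed.

(** Almost minimisers [u j] of the [L^2] norm are chosen so precise that almost surely they form a
    Cauchy sequence and are asymptotically invariant under each group element. Ergodicity forces the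
    limit to be a constant [c], and boundedness turns almost sure closeness to [c] into closeness in
    mean. *)
Lemma mean_ergodic (eps : R) : 0 < eps ->
  exists u, hull f u /\ mean P (fun x => `|u x - mean P f|) <= eps.
Proof.
move=> eps0.
have [e eE] := countable_enum cG.
pose a j : R := (2^-1) ^+ j.
have a0 j : 0 < a j by rewrite exprn_gt0.
have aS j : a j.+1 <= a j by rewrite /a exprS ler_piMl ?exprn_ge0// invf_le1 ?ler1n.
have a_anti : {homo a : i j / (i <= j)%N >-> j <= i}.
  by apply: homo_leq => // x y z /[swap]; exact: le_trans.
(* With tolerance [a j ^+ 3 / 4], the parallelogram estimate bounds the mean squared distance by
   [a j ^+ 3], and Markov's inequality at height [a j ^+ 2] leaves the summable probability
   [a j]. *)
have [|u uP] := @choice nat (T -> R)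
    (fun j u => hull f u /\ energy u <= dmin + a j ^+ 3 / 4).
  move=> j.
  have ej : 0 < a j ^+ 3 / 4 by rewrite divr_gt0// exprn_gt0.
  have [_ [v hv <-] vle] := inf_adherent ej has_inf_energy.
  by exists v; split=> //; exact: ltW.
have hu j : hull f (u j) by case: (uP j).
have bu j := hull_bdm (hu j).
have uM j := hull_bound (hu j).
have eu j i : (j <= i)%N -> energy (u i) <= dmin + a j ^+ 3 / 4.
  move=> ji; case: (uP i) => _ /le_trans; apply.
  by rewrite lerD2l ler_wpM2r// lerXn2r ?nnegrE ?(ltW (a0 _))// a_anti.
have far (v : T -> R) j : bdm v -> hull f v -> energy v <= dmin + a j ^+ 3 / 4 ->
    fine (P [set x | a j * a j <= (v x - u j x) * (v x - u j x)]) <= a j.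
  move=> bv hv ev.
  have b2 : bdm (fun x => (v x - u j x) * (v x - u j x)).
    by apply: bdmM; exact: bdmB.
  rewrite -(@ler_pM2l _ (a j * a j)) ?mulr_gt0//.
  apply: (@le_trans _ _ (mean P (fun x => (v x - u j x) * (v x - u j x)))).
    by apply: prob_markov => // x; rewrite -expr2 sqr_ge0.
  apply: le_trans (hull_close hv (hu j) ev (eu j j (leqnn _))) _.
  by rewrite le_eqVlt; apply/orP; left; apply/eqP; field.
have mfar (v : T -> R) j : bdm v ->
    measurable [set x | a j * a j <= (v x - u j x) * (v x - u j x)].
  move=> bv; rewrite -[X in measurable X]setTI; apply: measurable_fun_le => //.
  by case: (bdmM (bdmB bv (bu j)) (bdmB bv (bu j))).
pose A0 j := [set x | a j * a j <= (u j.+1 x - u j x) * (u j.+1 x - u j x)].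
pose A1 g j := [set x | a j * a j <= (u j (act g x) - u j x) * (u j (act g x) - u j x)].
have near0 (v : R) j : ~ (a j * a j <= v * v) -> `|v| < a j.
  move/negP; rewrite -ltNge -!expr2 -[v ^+ 2]real_normK ?num_real//.
  by rewrite ltr_pXn2r ?nnegrE// ltW.
pose N := lim_sup_set A0 `|` \bigcup_n lim_sup_set (A1 (e n)).
have mA0 j : measurable (A0 j) by apply: mfar; exact: bu.
have mA1 g j : measurable (A1 g j) by apply: mfar; exact/bdm_act/bu.
have mN : measurable N.
  apply: measurableU; first exact: measurable_lim_sup_set.
  by apply: bigcup_measurable => n _; exact: measurable_lim_sup_set.
have negN : P.-negligible N.
  apply: negligibleU.
    apply/negligibleP; first exact: measurable_lim_sup_set.
    by apply: borel_cantelli_half => // j; apply: far => //; exact: eu.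
  apply: negligible_bigcup => n.
  apply/negligibleP; first exact: measurable_lim_sup_set.
  apply: borel_cantelli_half => // j; apply: far.
  - exact: bdm_act.
  - exact: hull_act.
  - rewrite /energy (mean_act (e n) (bdmM (bu j) (bu j))).
    exact: eu.
have cauchy x : ~ N x -> \forall j \near \oo, forall i, (j <= i)%N ->
    `|u i x - u j x| <= 2 * a j.
  move=> Nx.
  have Ax : ~ lim_sup_set A0 x by move=> h; apply: Nx; left.
  have [J _ hJ] := lim_sup_setPn Ax.
  exists J => // j /= Jj i ji.
  rewrite -(subnKC ji); move: (i - j)%N => m {ji}; elim: m j Jj => [|m ih] j Jj.
    by rewrite addn0 subrr normr0 mulr_ge0// ltW.
  rewrite addnS -addSn.
  have := ih j.+1 (leqW Jj).
  have := near0 _ _ (hJ j Jj).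
  have -> : u (j.+1 + m)%N x - u j x =
    (u j.+1 x - u j x) + (u (j.+1 + m)%N x - u j.+1 x) by ring.
  move=> h1 h2; apply: le_trans (ler_normD _ _) _.
  by apply: le_trans (lerD (ltW h1) h2) _; rewrite /a exprS; lra.
(* Uniting over the whole orbit makes [S q] exactly invariant, as the ergodicity hypothesis
   requires; the same condition at [x] alone need not be invariant. *)
pose S q := \bigcup_n (act (e n) @^-1` lim_sup_set (fun j => [set x | q <= u j x])).
have mS q : measurable (S q).
  apply: bigcup_measurable => n _.
  rewrite -[X in measurable X]setTI; apply: mact => //.
  apply: measurable_lim_sup_set => j.
  rewrite -[X in measurable X]setTI; apply: measurable_fun_le => //.
  by case: (bu j).
have invS q g : act g @^-1` S q = S q.
  apply/seteqP; split => x [n _ /= h].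
    by have [m em] := eE (e n * g)%g; exists m => //=; rewrite em actM.
  have [m em] := eE (e n * g^-1)%g; exists m => //=.
  by rewrite em actM -(actM g^-1%g) mulVg act1.
(* Off [N], membership in [S q] passes back to the point itself: one third of [eta] pays for the
   move along the orbit, two thirds for the Cauchy tail. *)
have lowS q x (eta : R) : 0 < eta -> ~ N x -> S q x ->
    \forall j \near \oo, q - eta <= u j x.
  move=> eta0 Nx [n _ /= hq].
  have n1 : \forall j \near \oo, `|u j (act (e n) x) - u j x| < a j.
    have Ax : ~ lim_sup_set (A1 (e n)) x by move=> h; apply: Nx; right; exists n.
    by apply: filterS (lim_sup_setPn Ax) => j; exact: near0.
  have n2 : \forall j \near \oo, a j <= eta / 3.
    by apply: half_expn_le; rewrite divr_gt0.
  have [J _ hJ] := filterI (filterI n1 n2) (cauchy x Nx).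
  have [j /= Jj qj] := hq J I.
  exists j => // i /= ji.
  have [[]] := hJ j Jj.
  move=> h1 h2 /(_ i ji); move: h1 h2 qj.
  by rewrite !ltr_norml !ler_norml => /andP[? ?] ? ? /andP[? ?]; lra.
have upS q x : ~ S q x -> \forall j \near \oo, u j x < q.
  move=> Sx; have [m em] := eE 1%g.
  have Ax : ~ lim_sup_set (fun j => [set x | q <= u j x]) x.
    by move=> h; apply: Sx; exists m => //=; rewrite em act1.
  by apply: filterS (lim_sup_setPn Ax) => j /= /negP; rewrite -ltNge.
have S01 q : P (S q) = 0%E \/ P (S q) = 1%E by apply: erg.
pose E := [set q | P (S q) = 1%E].
have supE : has_sup E.
  split.
    exists (- M); rewrite /E/= (_ : S _ = setT) ?probability_setT//.
    apply/seteqP; split => // x _; exists 0%N => //= n _; exists n => //=.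
    by have := uM n (act (e 0) x); rewrite ler_norml => /andP[].
  exists M => q; rewrite /E/=.
  have [->|/set0P[x [n _ /= h]] _] := eqVneq (S q) set0.
    by rewrite measure0 => /eqP; rewrite eq_sym onee_eq0.
  have [j _ /= qj] := h 0%N I; apply: le_trans qj _.
  by have := uM j (act (e n) x); rewrite ler_norml => /andP[].
(* [c] is the candidate for the almost sure limit: some [S q] with [q] just below [c] has
   probability [1], and above [c] ergodicity leaves only probability [0]. *)
set c := sup E.
pose t := eps / 8; have t0 : 0 < t by rewrite divr_gt0.
have [q1 Eq1] := sup_adherent t0 supE; rewrite -/c => cq1.
have negq2 : P.-negligible (S (c + t)).
  apply/negligibleP => //; case: (S01 (c + t)) => // Ec.
  have : c + t <= c by exact: (sup_upper_bound supE).
  by rewrite gerDl leNgt t0.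
pose D j := [set x | 2 * t <= `|u j x - c|].
have mD j : measurable (D j).
  rewrite -[X in measurable X]setTI; apply: measurable_fun_le => //.
  by case: (bdm_norm (bdmB (bu j) (bdm_cst _ c))).
have negD : P.-negligible (lim_sup_set D).
  apply: (@negligibleS _ _ _ _ (N `|` (~` S q1 `|` S (c + t)))); last first.
    apply: negligibleU => //; apply: negligibleU => //.
    apply/negligibleP; first exact: measurableC.
    transitivity (1 - P (S q1))%E; first exact: probability_setC.
    by rewrite Eq1 subee.
  move=> x Dx; apply: contrapT => /not_orP[Nx /not_orP[/contrapT S1 S2]].
  have [J _ hJ] := filterI (lowS _ _ _ t0 Nx S1) (upS _ _ S2).
  have [j /= Jj] := Dx J I; have [] := hJ j Jj.
  by rewrite /D/= ler_normr => h1 h2 /orP[]; lra.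
have M0 : 0 <= M by exact: le_trans (normr_ge0 _) (fM point).
have [n Pn] : exists n, (M + `|c|) * fine (P (D n)) <= t.
  have Mc : 0 < M + `|c| + 1 by rewrite ltr_wpDl// addr_ge0.
  have t1 : 0 < t / (M + `|c| + 1) by rewrite divr_gt0.
  have [n] := lim_sup_set_negligible mD negD t1.
  rewrite ler_pdivlMr// => h; exists n; apply: le_trans h; rewrite mulrC.
  by rewrite ler_wpM2l ?fine_ge0// lerDl.
exists (u n); split => //.
have bn : bdm (fun x => `|u n x - c|) by apply/bdm_norm/bdmB => //; exact: bdm_cst.
have dc : mean P (fun x => `|u n x - c|) <= 3 * t.
  have bD := bdm_indic R (mD n).
  apply: (@le_trans _ _ (mean P (fun x => 2 * t + (M + `|c|) * \1_(D n) x))).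
    apply: le_mean => //; first by apply: bdmD; [exact: bdm_cst|exact: bdmZ].
    move=> x; rewrite indicE; case: (boolP (x \in D n)) => [_|].
      rewrite mulr1; apply: le_trans (ler_normB _ _) _.
      by have := uM n x; lra.
    rewrite notin_setE /D/= => /negP; rewrite -ltNge mulr0 addr0.
    exact: ltW.
  rewrite meanD ?mean_cst ?meanZ ?mean_indic//; [|exact: bdm_cst|exact: bdmZ].
  by lra.
have dm : `|mean P f - c| <= 3 * t.
  apply: le_trans dc; rewrite -(hull_mean (hu n)).
  rewrite -{1}(mean_cst P c) -meanB//; last exact: bdm_cst.
  by apply: le_normr_Rintegral => //; apply: bdm_integrable; apply: bdmB => //; exact: bdm_cst.
apply: (@le_trans _ _ (mean P (fun x => `|u n x - c| + `|mean P f - c|))).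
  apply: le_mean.
  - by apply/bdm_norm/bdmB => //; exact: bdm_cst.
  - by apply: bdmD => //; exact: bdm_cst.
  move=> x; rewrite -[X in _ <= _ + X]normrN opprB.
  by apply: le_trans (ler_normD _ _); rewrite addrA subrK.
rewrite meanD ?mean_cst//; last exact: bdm_cst.
by rewrite /t in dc dm; lra.
Qed.

End MeanErgodic.

(** * The pointwise ergodic theorem *)

Section PointwiseErgodic.
Variables (G : groupType) (R : realType) (d : measure_display) (T : measurableType d).
Variables (P : probability T R) (act : G -> T -> T) (F : nat -> {fset G}).
Hypotheses (cG : countable_group G) (mp : mp_action P act)
  (erg : ergodic_action P act).
Hypothesis folner : forall g,
  (fun n => #|` lsdiff g (F n)|%:R / (#|` F n|)%:R : R) @ \oo --> (0 : R).
Hypothesis F0 : forall k, (k <= #|` F k|)%N.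

Let actM g g' x : act (g * g')%g x = act g (act g' x).
Proof. by case: mp => _ []. Qed.

Definition orbsum (L : {fset G}) (u : T -> R) x : R := \sum_(a <- L) u (act a x).

Lemma bdm_orbsum L u : bdm u -> bdm (orbsum L u).
Proof. by move=> bu; apply: bdm_sum => a; exact: bdm_act mp _ _ bu. Qed.

Lemma mean_orbsum L u : bdm u -> mean P (orbsum L u) = #|` L|%:R * mean P u.
Proof.
move=> bu; rewrite mean_sum => [|a]; last exact: bdm_act mp _ _ bu.
under eq_bigr => a _ do rewrite (mean_act mp)//.
by rewrite big_const_seq count_predT iter_addr addr0 mulr_natl.
Qed.

(** By induction on the hull: composing with [g] changes the orbit sum only on the symmetric
    difference of [F k] and [g F k], which is eventually small. The bound is uniform in [x]. *)
Lemma orbsum_hull (f u : T -> R) (M eps : R) : (forall x, `|f x| <= M) ->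
  hull act f u -> 0 < eps ->
  \forall k \near \oo, forall x,
    `|orbsum (F k) f x - orbsum (F k) u x| <= eps * #|` F k|%:R.
Proof.
move=> fM hu; elim: hu eps => [|g v hv ih|v w _ ihv _ ihw] eps e0.
- by near=> k => x; rewrite subrr normr0 mulr_ge0// ltW.
- have M0 : 0 <= M by exact: le_trans (normr_ge0 _) (fM point).
  have e2 : 0 < eps / 2 by rewrite divr_gt0.
  have e1 : 0 < eps / 2 / (M + 1) by rewrite divr_gt0// ltr_wpDl.
  have [m1 _ hm1] := ih _ e2.
  have [m2 _ hm2] := @folner_sum _ _ _ folner F0 [fset g]%fset _ e1.
  exists (maxn m1 m2) => // k /=; rewrite geq_max => /andP[/hm1 h1 /hm2 h2] x.
  have -> : orbsum (F k) f x - orbsum (F k) (fun x => v (act g x)) x =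
    (orbsum (F k) f x - orbsum (F k) v x) +
    \sum_(a <- F k) (v (act a x) - v (act (g * a)%g x)).
    rewrite sumrB addrA subrK; congr (_ - _).
    by apply: eq_bigr => a _; rewrite actM.
  apply: le_trans (ler_normD _ _) _.
  have vM : forall y, `|v y| <= M by exact: hull_bound fM _ hv.
  have := @sum_flmul_le _ _ g (F k) (fun a => v (act a x)) M (fun a => vM _).
  move: h2; rewrite big_seq_fset1 => h2 h3.
  have h4 : M * #|` lsdiff g (F k)|%:R <= eps / 2 * #|` F k|%:R.
    apply: (@le_trans _ _ ((M + 1) * #|` lsdiff g (F k)|%:R)).
      by rewrite ler_wpM2r// lerDl.
    rewrite mulrC -ler_pdivlMr ?ltr_wpDl//; apply: le_trans h2 _.
    by rewrite mulrAC.
  by have := h1 x; lra.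
- have [m1 _ hm1] := ihv _ e0; have [m2 _ hm2] := ihw _ e0.
  exists (maxn m1 m2) => // k /=; rewrite geq_max => /andP[/hm1 h1 /hm2 h2] x.
  have -> : orbsum (F k) (fun x => 2^-1 * (v x + w x)) x =
    2^-1 * (orbsum (F k) v x + orbsum (F k) w x).
    by rewrite /orbsum -mulr_sumr big_split.
  set a := orbsum _ f x; set b := orbsum _ v x; set c := orbsum _ w x.
  have -> : a - 2^-1 * (b + c) = 2^-1 * ((a - b) + (a - c)) by field.
  rewrite normrM ger0_norm ?invr_ge0// mulrC ler_pdivrMr//.
  apply: le_trans (ler_normD _ _) _.
  by have := h1 x; have := h2 x; rewrite -/a -/b -/c; lra.
Unshelve. all: by end_near. Qed.

Variable C : R.
Hypothesis temper : forall n, (1 <= n)%N ->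
  #|` Defs.fprod (fbigcup_lt (fun k => finvs (F k)) n) (F n)|%:R <= C * #|` F n|%:R.

Let Fpos n : (1 <= n)%N -> (0 < #|` F n|)%N.
Proof. by move=> n1; apply: leq_trans (F0 n). Qed.

Let C0 : 0 <= C.
Proof.
have := temper (leqnn 1); have := Fpos (leqnn 1); rewrite -(ltr0n R) => F1 h.
by rewrite -(pmulr_lge0 _ F1); apply: le_trans h; exact: ler0n.
Qed.

Definition exceed (la : R) (u : T -> R) N : set T :=
  [set x | exists n, [/\ (1 <= n)%N, (n <= N)%N & la * #|` F n|%:R <= orbsum (F n) u x]].

Lemma measurable_exceed la u N : bdm u -> measurable (exceed la u N).
Proof.
move=> bu.
rewrite (_ : exceed _ _ _ = \bigcup_(n in [set n | (1 <= n <= N)%N])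
    [set x | la * #|` F n|%:R <= orbsum (F n) u x]).
  apply: bigcup_measurable => n _; rewrite -[X in measurable X]setTI.
  apply: measurable_fun_le => //.
  by case: (bdm_orbsum (F n) bu).
apply/seteqP; split => [x [n [n1 nN h]]|x [n /= /andP[n1 nN] h]]; exists n => //=.
by rewrite n1.
Qed.

(** Transference: the finite covering bound is applied along each orbit to the times in a window
    [F m] so invariant that [D F_m] has at most twice its size, then integrated. This is the source
    of the factor [2]. *)
Lemma maximal_inequality la u N : bdm u -> (forall x, 0 <= u x) -> 0 <= la ->
  la * fine (P (exceed la u N)) <= 2 * (1 + C) * mean P u.
Proof.
move=> bu u0 la0; pose A := exceed la u N.
have mA : measurable A by exact: measurable_exceed.
pose D := \big[fsetU/fset0]_(n <- iota 0 N.+1) F n.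
have FD n g : (n <= N)%N -> g \in F n -> g \in D.
  move=> nN gF; apply/bigfcupP; exists n => //.
  by rewrite mem_iota andbT.
have [m [m1 mD]] : exists m, (1 <= m)%N /\
    #|` Defs.fprod D (F m)|%:R <= 2 * #|` F m|%:R :> R.
  have [m0 _ hm] := @folner_fprod _ _ _ folner F0 D.
  by exists m0.+1; split=> //; exact: (hm _ (leqnSn _)).
have pt x : la * orbsum (F m) (\1_A) x <=
    (1 + C) * orbsum (Defs.fprod D (F m)) u x.
  have [nu nuP] : {nu : G -> nat & forall a, A (act a x) ->
      [/\ (1 <= nu a)%N, (nu a <= N)%N &
        la * #|` F (nu a)|%:R <= orbsum (F (nu a)) u (act a x)]}.
    apply: (@choice _ _ (fun a n => A (act a x) -> [/\ (1 <= n)%N, (n <= N)%N &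
      la * #|` F n|%:R <= orbsum (F n) u (act a x)])) => a.
    have [[n h]|nA] := pselect (A (act a x)); first by exists n.
    by exists 0%N.
  pose B := [fset a in F m | act a x \in A]%fset.
  have BP a : a \in B -> A (act a x) by rewrite !inE => /andP[_]; rewrite inE.
  have -> : orbsum (F m) (\1_A) x = #|` B|%:R.
    rewrite card_fset_sum1 natr_sum big_fset/= big_mkcond/=.
    by apply: eq_bigr => a _; rewrite indicE; case: (_ \in A).
  apply: (@tempered_maximal_count _ _ F B nu _ _ temper _ _ (fun g => u (act g x))) => //.
  - move=> a /BP /nuP[n1 _ _]; rewrite -cardfs_gt0; exact: Fpos.
  - by move=> a /BP /nuP[].
  - move=> a v aB vF; apply/imfset2P; exists v => /=.
      by have /BP/nuP[_ nN _] := aB; exact: FD nN vF.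
    by exists a => //=; move: aB; rewrite !inE => /andP[].
  - move=> a /BP/nuP[_ _] /le_trans; apply.
    by rewrite /orbsum; under eq_bigr do rewrite -actM.
have bA := bdm_indic R mA.
have := @le_mean _ _ _ P _ _ (bdmZ la (bdm_orbsum (F m) bA))
  (bdmZ (1 + C) (bdm_orbsum (Defs.fprod D (F m)) bu)) pt.
rewrite !meanZ; [|exact: bdm_orbsum..].
rewrite !mean_orbsum// mean_indic// => h.
have Fm : 0 < #|` F m|%:R :> R by rewrite ltr0n Fpos.
rewrite -(ler_pM2l Fm) mulrCA; apply: le_trans h _.
have -> : #|` F m|%:R * (2 * (1 + C) * mean P u) =
  (1 + C) * ((2 * #|` F m|%:R) * mean P u) by ring.
rewrite ler_wpM2l ?addr_ge0// ler_wpM2r//.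
exact: mean_ge0.
Qed.

Lemma maximal_inequality_bigcup la u : bdm u -> (forall x, 0 <= u x) -> 0 < la ->
  fine (P (\bigcup_N exceed la u N)) <= 2 * (1 + C) * mean P u / la.
Proof.
move=> bu u0 la0.
have mE N := measurable_exceed la N bu.
have h : fine \o (P \o exceed la u) @ \oo --> fine (P (\bigcup_N exceed la u N)).
  apply: fine_cvg; rewrite fine_prob; last exact: bigcup_measurable.
  apply: nondecreasing_cvg_mu => //; first exact: bigcup_measurable.
  move=> i j ij; apply/subsetPset => x [n [n1 ni hn]].
  by exists n; split=> //; exact: leq_trans ij.
rewrite -(cvg_lim _ h)//.
apply: limr_le; first by apply/cvg_ex; eexists; exact: h.
near=> N; rewrite ler_pdivlMr// mulrC /=; apply: maximal_inequality => //.
exact: ltW.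
Unshelve. all: by end_near. Qed.

(** The orbit sums of [f] and of a hull element [u] that is nearly constant in mean eventually
    differ by at most [eps |F k|]. A deviation by [2 eps |F k|] infinitely often thus makes some
    orbit average of [|u - mean f|] reach [eps], which the maximal inequality renders improbable. *)
Theorem pointwise_ergodic (f : T -> R) (eps : R) : bdm f -> 0 < eps ->
  P.-negligible (lim_sup_set (fun k => [set x |
    2 * eps * #|` F k|%:R <= `|orbsum (F k) f x - mean P f * #|` F k|%:R|])).
Proof.
move=> bf e0; have [mf [M fM]] := bf.
set Z := lim_sup_set _.
have mZ : measurable Z.
  apply: measurable_lim_sup_set => k; rewrite -[X in measurable X]setTI.
  apply: measurable_fun_le => //.
  case: (bdm_norm (bdmB (bdm_orbsum (F k) bf) (bdm_cst T (mean P f * #|` F k|%:R)))).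
  by [].
apply/negligibleP => //; rewrite -[LHS]fine_prob//; congr _%:E.
apply/eqP; rewrite eq_le fine_ge0// andbT.
apply/ler_addgt0Pr => t t0; rewrite add0r.
(* Chosen so that the maximal inequality yields [2 (1 + C) eta / eps = t]. *)
pose eta := t * eps / (2 * (1 + C)).
have C1 : 0 < 1 + C by rewrite ltr_pwDl.
have eta0 : 0 < eta by rewrite !(divr_gt0, mulr_gt0).
have [u [hu ue]] := mean_ergodic cG mp erg mf fM eta0.
have bu := hull_bdm mp mf fM hu.
have bv : bdm (fun x => `|u x - mean P f|).
  by apply/bdm_norm/bdmB => //; exact: bdm_cst.
apply: (@le_trans _ _ (fine (P (\bigcup_N exceed eps (fun x => `|u x - mean P f|) N)))).
  rewrite fine_le ?fin_num_measure// ?le_measure ?inE//.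
  - by apply: bigcup_measurable => N _; exact: measurable_exceed.
  - by apply: bigcup_measurable => N _; exact: measurable_exceed.
  have [n0 _ hn0] := orbsum_hull fM hu e0.
  move=> x Zx; have [n /= n0n hn] := Zx n0.+1 I.
  exists n => //; exists n; split=> //; first exact: leq_ltn_trans n0n.
  have := hn0 n (ltnW n0n) x => h1.
  have h2 : `|orbsum (F n) u x - mean P f * #|` F n|%:R| <=
      orbsum (F n) (fun x => `|u x - mean P f|) x.
    apply: le_trans (ler_norm_sum _ _ _).
    by rewrite sumrB big_const_seq count_predT iter_addr addr0 mulr_natr.
  apply: le_trans h2.
  have h3 := ler_normD (orbsum (F n) f x - orbsum (F n) u x)
    (orbsum (F n) u x - mean P f * #|` F n|%:R).
  rewrite addrA subrK in h3.
  by lra.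
apply: le_trans (maximal_inequality_bigcup bv _ e0) _ => //.
rewrite ler_pdivrMr// mulrC -ler_pdivlMr ?mulr_gt0//.
Qed.

End PointwiseErgodic.

(** * Counting typical words *)

Section TypicalCount.
Variables (G : groupType) (R : realType) (Sg : finType) (s0 : Sg).
Variables (K L : {fset G}).
Implicit Types (y : {ffun L -> Sg}) (f g : G).

(** The default letter [s0] makes [pattern] total; it is never read when [f] lies in [L] and is
    inner. *)
Definition extend y g : Sg := if insub g is Some i then y i else s0.

Definition pattern f y : {ffun K -> Sg} := [ffun g => extend y (fsval g * f)%g].

Definition inner f := f \notin boundary K L.

Lemma extend_val y (i : L) : extend y (fsval i) = y i.
Proof. by rewrite /extend valK. Qed.

Lemma inner_mem f g : f \in L -> inner f -> g \in K -> (g * f)%g \in L.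
Proof.
move=> fL; rewrite /inner !inE fL/= => /hasPn h gK.
by have := h _ gK; rewrite negbK.
Qed.

(** Overwriting a word on the translate [K f] by an arbitrary word on [K] is injective as long as
    the pattern overwritten is the prescribed [w], since then no information is lost. *)
Lemma card_pattern_fiber f (w : {ffun K -> Sg}) : f \in L -> inner f ->
  (#|[pred y | pattern f y == w]| * #|{ffun K -> Sg}| <= #|{ffun L -> Sg}|)%N.
Proof.
move=> fL fi.
pose over (p : {ffun L -> Sg} * {ffun K -> Sg}) : {ffun L -> Sg} :=
  [ffun i => if insub (fsval i * f^-1)%g is Some g then p.2 g else p.1 i].
have over1 y v (g : K) : extend (over (y, v)) (fsval g * f)%g = v g.
  have gL := inner_mem fL fi (fsvalP g).
  rewrite -[(fsval g * f)%g]/(fsval [` gL]%fset) extend_val ffunE/=.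
  rewrite mulgK.
  by rewrite valK.
have inj : {in [pred p | pattern f p.1 == w] &, injective over}.
  move=> [y v] [y' v'] /eqP/= yw /eqP/= yw' e.
  have -> : v = v' by apply/ffunP => g; rewrite -(over1 y v) -(over1 y' v') e.
  congr pair; apply/ffunP => i.
  have [iK|iK] := boolP ((fsval i * f^-1)%g \in K).
    have := congr1 (fun w : {ffun K -> Sg} => w [` iK]%fset) (etrans yw (esym yw')).
    by rewrite !ffunE/= mulgVK !extend_val.
  by move/ffunP/(_ i): e; rewrite !ffunE insubN.
have <- : #|[pred p : {ffun L -> Sg} * {ffun K -> Sg} | pattern f p.1 == w]| =
    (#|[pred y | pattern f y == w]| * #|{ffun K -> Sg}|)%N.
  rewrite -cardX; apply: eq_card => -[y v].
  by rewrite !inE andbT.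
rewrite -(card_in_image inj); exact: max_card.
Qed.

Variable phi : {ffun K -> Sg} -> R.
Hypothesis K0 : K != fset0.
Hypothesis phi1 : \sum_w expR (- phi w) <= 1.

Let N : R := #|Sg|%:R.
Let Nge1 : 1 <= N.
Proof. by rewrite ler1n; apply/card_gt0P; exists s0. Qed.

Lemma avg_pattern_le f : f \in L -> inner f ->
  (\sum_y expR (- phi (pattern f y))) / #|{ffun L -> Sg}|%:R <= N ^- #|` K|.
Proof.
move=> fL fi.
have L0 : 0 < #|{ffun L -> Sg}|%:R :> R.
  by rewrite ltr0n; apply/card_gt0P; exists [ffun=> s0].
have NK : #|{ffun K -> Sg}|%:R = N ^+ #|` K| :> R.
  by rewrite card_ffun natrX -cardfE.
have K1 : 0 < N ^+ #|` K| by rewrite exprn_gt0// (lt_le_trans ltr01).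
rewrite ler_pdivrMr// mulrC ler_pdivlMr//.
rewrite (partition_big (pattern f) xpredT)//= mulr_suml.
apply: (@le_trans _ _ (\sum_w expR (- phi w) * #|{ffun L -> Sg}|%:R)).
  apply: ler_sum => w _.
  under eq_bigr => y /eqP -> do over.
  rewrite sumr_const -[X in X * _]mulr_natr -mulrA ler_wpM2l ?expR_ge0//.
  by rewrite -NK -natrM ler_nat card_pattern_fiber.
by rewrite -mulr_suml -[leRHS]mul1r ler_wpM2r// ltW.
Qed.

(** Finner's inequality with [r = |K|]: a point [i] lies in [K f] only for [f \in K^-1 i]. Kraft's
    inequality [phi1] makes each inner [f] save a factor [|Sg|], so the number [|Sg|^|L|] of words
    is compensated up to the boundary. *)
Lemma sum_typical_weight :
  \sum_y expR (\sum_(f : L | inner (fsval f)) - phi (pattern (fsval f) y) / #|` K|%:R)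
    <= expR (#|` boundary K L|%:R * ln N).
Proof.
have r0 : (0 < #|` K|)%N by rewrite cardfs_gt0.
have rR : 0 < #|` K|%:R :> R by rewrite ltr0n.
have S0 : (0 < #|Sg|)%N by apply/card_gt0P; exists s0.
have N0 : 0 < N by rewrite (lt_le_trans ltr01).
pose S (f : L) : {set L} :=
    finset (fun i : L => inner (fsval f) && ((fsval i * (fsval f)^-1)%g \in K)).
pose psi (f : L) y := if inner (fsval f) then - phi (pattern (fsval f) y) else 0.
have Sr (i : L) : (#|[pred f | i \in S f]| <= #|` K|)%N.
  apply: (@leq_trans #|[pred f : L | (fsval i * (fsval f)^-1)%g \in K]|).
    by apply: subset_leq_card; apply/fintype.subsetP => f; rewrite !inE => /andP[].
  rewrite cardE -(size_map (fun f : L => (fsval i * (fsval f)^-1)%g)).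
  apply: uniq_leq_size => [|x /mapP[f]]; last by rewrite mem_enum inE => fK ->.
  by rewrite map_inj_uniq ?enum_uniq// => f f' /mulgI/invg_inj/val_inj.
have indS (f : L) (i : L) : i \notin S f -> indep i (psi f).
  rewrite /S finset.in_set negb_and /psi => h y s.
  case: ifPn => // fi; move: h; rewrite fi/= => ik; congr (- phi _).
  apply/ffunP => g; rewrite !ffunE.
  have gL := inner_mem (fsvalP f) fi (fsvalP g).
  rewrite -[(fsval g * fsval f)%g]/(fsval [` gL]%fset) !extend_val ffunE.
  case: eqP => // gi; move: ik; rewrite -gi /= mulgK.
  by rewrite (fsvalP g).
have := finner S0 r0 Sr indS.
have L0 : 0 < #|{ffun L -> Sg}|%:R :> R.
  by rewrite ltr0n; apply/card_gt0P; exists [ffun=> s0].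
rewrite ler_pdivrMr// => h.
have -> : \sum_y expR (\sum_(f : L | inner (fsval f))
      - phi (pattern (fsval f) y) / #|` K|%:R) =
   \sum_y expR (\sum_f psi f y / #|` K|%:R).
  apply: eq_bigr => y _; congr expR; rewrite big_mkcond/=.
  by apply: eq_bigr => f _; rewrite /psi; case: ifP; rewrite ?mul0r.
apply: le_trans h _.
have LE : #|{ffun L -> Sg}|%:R = expR (#|` L|%:R * ln N) :> R.
  by rewrite card_ffun natrX -cardfE expRM_natl lnK.
rewrite [X in _ * X <= _]LE -expRD ler_expR.
have -> : #|` boundary K L|%:R = #|` L|%:R - \sum_(f : L) (inner (fsval f))%:R :> R.
  apply/eqP; rewrite eq_sym subr_eq; apply/eqP.
  have -> : \sum_(f : L) (inner (fsval f))%:R = \sum_(f <- L) (inner f)%:R :> R.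
    by rewrite [RHS]big_seq_fsetE.
  rewrite !card_fset_sum1 !natr_sum big_fset/= [X in _ = X + _]big_mkcond/= -big_split/=.
  rewrite big_seq [RHS]big_seq; apply: eq_bigr => f fL.
  by rewrite /inner !inE fL/=; case: (has _ _); rewrite ?addr0 ?add0r.
rewrite mulrBl [X in X <= _]addrC lerD2l mulr_suml -sumrN; apply: ler_sum => f _.
rewrite -mulNr.
rewrite ler_pdivrMr// /psi; case: (boolP (inner (fsval f))) => fi; last first.
  under eq_bigr do rewrite expR0.
  by rewrite sumr_const divff ?gt_eqF// ln1 oppr0 mul0r mul0r.
have avg0 : 0 < (\sum_y expR (- phi (pattern (fsval f) y))) / #|{ffun L -> Sg}|%:R.
  rewrite divr_gt0// (bigD1 [ffun=> s0])//= ltr_pwDl ?expR_gt0//.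
  by apply: sumr_ge0 => y _; exact: expR_ge0.
apply: (@le_trans _ _ (ln (N ^- #|` K|))).
  rewrite ler_ln ?posrE//; last by rewrite invr_gt0 exprn_gt0.
  by apply: avg_pattern_le => //; exact: fsvalP.
rewrite lnV ?posrE ?exprn_gt0// lnXn// -[X in - X <= _]mulr_natr.
by rewrite le_eqVlt; apply/orP; left; apply/eqP; rewrite /=; ring.
Qed.

(** Markov's inequality for the counting measure: every word counted has weight at least
    [expR (- c)]. *)
Lemma card_typical (c : R) :
  #|[pred y | \sum_(f : L | inner (fsval f)) phi (pattern (fsval f) y)
       <= #|` K|%:R * c]|%:R <= expR (c + #|` boundary K L|%:R * ln N).
Proof.
set A := [pred y | _].
have rR : 0 < #|` K|%:R :> R by rewrite ltr0n cardfs_gt0.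
rewrite expRD -ler_pdivrMl ?expR_gt0// -expRN.
apply: le_trans sum_typical_weight.
rewrite [leRHS](bigID (mem A))/= -[leLHS]addr0 lerD//; last first.
  by apply: sumr_ge0 => y _; exact: expR_ge0.
rewrite mulr_natr -sumr_const; apply: ler_sum => y; rewrite inE => h.
by rewrite ler_expR -mulr_suml sumrN mulNr lerN2 ler_pdivrMr// mulrC.
Qed.

End TypicalCount.

(** * Rare returns *)

Section GreedyCover.
Variables (G : groupType) (W : {fset G}).
Hypothesis W1 : 1%g \in W.

(** The list is scanned in order, and an element becomes a centre exactly when no earlier translate
    covers it; as [1 \in W], it then covers itself. *)
Lemma greedy_cover (l : seq G) : exists s : seq G,
  [/\ {subset s <= l},
      forall i, (i < size s)%N ->
        nth 1%g s i \notin \big[fsetU/fset0]_(j < i) frmul W (nth 1%g s j) &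
      forall a, a \in l -> a \in \big[fsetU/fset0]_(f <- s) frmul W f].
Proof.
elim/last_ind: l => [|l a [s [sl sW lW]]]; first by exists [::].
have [aW|aW] := boolP (a \in \big[fsetU/fset0]_(f <- s) frmul W f).
  exists s; split=> // [f /sl fl|b]; first by rewrite mem_rcons inE fl orbT.
  by rewrite mem_rcons inE => /predU1P[->|/lW].
exists (rcons s a); split.
- by move=> f; rewrite !mem_rcons !inE => /predU1P[->|/sl ->]; rewrite ?eqxx ?orbT.
- move=> i; rewrite size_rcons ltnS leq_eqVlt => /predU1P[->|si].
    rewrite nth_rcons ltnn eqxx; apply: contra aW.
    rewrite (big_nth 1%g) big_mkord.
    by under eq_bigr => j _ do rewrite nth_rcons ltn_ord.
  rewrite nth_rcons si.
  under eq_bigr => j _ do rewrite nth_rcons (ltn_trans (ltn_ord j) si).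
  exact: sW.
- move=> b; rewrite mem_rcons inE -cats1 big_cat big_seq1/= in_fsetU.
  move=> /predU1P[->|/lW ->//]; apply/orP; right.
  by rewrite mem_frmul mulgV.
Qed.

Variables (R : realType) (C : R).
Hypotheses (C0 : 0 < C) (WC : individually_filling W C).

(** Greedily chosen translates [W f] centred in [A] cover [A], and each holds at most [th |W|] of
    its points. Filling bounds the sum of the [|W f|] by [|W A| / C]. *)
Lemma filling_count (A : {fset G}) (th : R) : 0 <= th ->
  (forall f, f \in A -> #|` [fset a in A | a \in frmul W f]%fset|%:R <= th * #|` W|%:R) ->
  C * #|` A|%:R <= th * #|` Defs.fprod W A|%:R.
Proof.
move=> th0 hA; have [s [sA sW As]] := greedy_cover A.
apply: (@le_trans _ _ (C * (\sum_(f <- s) th * #|` W|%:R))).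
  apply: (ler_wpM2l (ltW C0)).
  apply: (@le_trans _ _ (\sum_(f <- s) #|` [fset a in A | a \in frmul W f]%fset|)%:R).
    rewrite ler_nat; apply: leq_trans (card_bigfcup_le _ _).
    apply/fsubset_leq_card/fsubsetP => a aA.
    have /bigfcupP[f /andP[fs _] af] := As a aA.
    by apply/bigfcupP; exists f; rewrite ?fs//; apply/imfsetP; exists a; rewrite //= !inE aA.
  rewrite natr_sum big_seq [leRHS]big_seq; apply: ler_sum => f /sA; exact: hA.
rewrite -mulr_sumr mulrCA ler_wpM2l//.
have := WC sW; rewrite natr_sum.
under eq_bigr do rewrite card_frmul.
move/le_trans; apply; rewrite ler_nat.
apply/fsubset_leq_card/fsubsetP => a /bigfcupP[f /andP[/sA fA _] /imfsetP[v /= vW ->]].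
by apply/imfset2P; exists v => //; exists f.
Qed.

End GreedyCover.

(** * Return times of a word along an orbit *)

Section Recurrence.
Variables (G : groupType) (R : realType) (d : measure_display) (T : measurableType d).
Variables (P : probability T R) (act : G -> T -> T) (Sg : finType) (X : T -> Sg).
Hypotheses (mp : mp_action P act) (mX : measurable_obs X).

Let act1 x : act 1%g x = x. Proof. by case: mp. Qed.
Let actM g g' x : act (g * g')%g x = act g (act g' x).
Proof. by case: mp => _ []. Qed.
Let mact g : measurable_fun setT (act g). Proof. by case: mp => _ [_ []]. Qed.

Definition word (L : {fset G}) x : {ffun L -> Sg} :=
  [ffun g => X (act (fsval g) x)].

Lemma measurable_word (L : {fset G}) (w : {ffun L -> Sg}) :
  measurable [set x | word L x = w].
Proof.
rewrite (_ : [set x | _] =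
    \bigcap_(g in [set: L]) (act (fsval g) @^-1` (X @^-1` [set w g]))).
  apply: fin_bigcap_measurable => [|g _].
    exact: finite_finset.
  by rewrite -[X in measurable X]setTI; apply: mact.
apply/seteqP; split => [x /= xw g _|x h] /=.
  by rewrite -xw ffunE.
by apply/ffunP => g; rewrite ffunE; exact: h.
Qed.

Lemma measurable_local (L : {fset G}) (B : set T) :
  (forall x x', word L x = word L x' -> B x -> B x') -> measurable B.
Proof.
move=> loc; rewrite (_ : B = \bigcup_(w in [set w | exists2 x, B x & word L x = w])
   [set x | word L x = w]).
  apply: fin_bigcup_measurable => [|w _]; last exact: measurable_word.
  exact: finite_finset.
apply/seteqP; split => [x Bx|x [w [x' Bx' <-] /esym/loc]]; last exact.
by exists (word L x) => //; exists x.
Qed.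

Lemma wordP (L : {fset G}) x x' : word L x = word L x' <->
  forall g, g \in L -> X (act g x) = X (act g x').
Proof.
split => [e g gL|h].
  by have := congr1 (fun w : {ffun L -> Sg} => w [` gL]%fset) e; rewrite !ffunE.
by apply/ffunP => g; rewrite !ffunE h.
Qed.

Lemma eq_Ufun (L W : {fset G}) x x' :
  word (L `|` Defs.fprod L W)%fset x = word (L `|` Defs.fprod L W)%fset x' ->
  Ufun R act X L W x = Ufun R act X L W x'.
Proof.
move=> /wordP h; rewrite /Ufun; congr (_%:R / _); apply: eq_bigl => E.
rewrite /admissible; congr [&& _, _ & _]; apply: eq_forallb => e.
congr (_ ==> _); apply: eq_forallb => g.
rewrite -!actM !h//.
  by rewrite in_fsetU (fsvalP g).
rewrite in_fsetU; apply/orP; right; apply/imfset2P.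
exists (fsval g); first exact: fsvalP.
by exists (fsval e); first exact: fsvalP.
Qed.

Lemma word_setU (L L' : {fset G}) x x' :
  word (L `|` L')%fset x = word (L `|` L')%fset x' -> word L x = word L x'.
Proof.
move=> /wordP h; apply/wordP => g gL; apply: h.
by rewrite in_fsetU gL.
Qed.

Variables (L W : {fset G}).
Hypotheses (L0 : L != fset0) (W1 : 1%g \in W).

Let maxE x := (\max_(E : {set W} | admissible act X L x E) #|E|)%N.

Lemma admissible1 x : admissible act X L x (finset.set1 [` W1]%fset).
Proof.
apply/and3P; split.
- by apply/existsP; exists [` W1]%fset; rewrite finset.in_set1 eqxx/= eqxx.
- apply/forallP => e; apply/implyP; rewrite finset.in_set1 => /eqP ->.
  apply/forallP => e'; apply/implyP; rewrite finset.in_set1 => /eqP ->.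
  by rewrite eqxx.
- apply/forallP => e; apply/implyP; rewrite finset.in_set1 => /eqP ->.
  by apply/forallP => g; rewrite /= act1.
Qed.

Lemma Ufun_gt0 x : 0 < Ufun R act X L W x.
Proof.
rewrite /Ufun divr_gt0// ltr0n; last by rewrite cardfs_gt0; apply/fset0Pn; exists 1%g.
have := @leq_bigmax_cond _ _ (fun E : {set W} => #|E|) _ (admissible1 x).
by apply: leq_trans; rewrite finset.cards1.
Qed.

(* A set [E] of maximal size meets, up to translation by [L^-1 L], every
   return time in [W]. *)
Lemma card_repeats x :
  (#|` [fset v in W | repeats act X L x v]%fset| <= #|` L| * #|` L| * maxE x)%N.
Proof.
have [E adE maxEE] : exists2 E : {set W}, admissible act X L x E & maxE x = #|E|.
  have A0 : (0 < #|[pred E : {set W} | admissible act X L x E]|)%N.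
    by apply/card_gt0P; exists (finset.set1 [` W1]%fset); exact: admissible1.
  have [E adE eE] := @eq_bigmax_cond _ _ (fun E : {set W} => #|E|) A0.
  by exists E.
rewrite maxEE; pose t := [seq (p.1^-1 * p.2 * fsval e)%g | p <- [seq (a, b) | a <- L, b <- L], e <- enum E].
have -> : (#|` L| * #|` L| * #|E| = size t)%N.
  by rewrite !size_allpairs -cardE.
apply: uniq_leq_size => [|v]; first exact: fset_uniq.
rewrite !inE => /andP[vW rv].
suff [e eIn [g]] : exists2 e, e \in E & exists2 g, g \in frmul L v & g \in frmul L (fsval e).
  rewrite !mem_frmul => gv ge.
  apply/allpairsP; exists ((g * v^-1)%g, (g * (fsval e)^-1)%g, e) => /=.
  split; [|by rewrite mem_enum|].
    by apply/allpairsP; exists ((g * v^-1)%g, (g * (fsval e)^-1)%g).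
  by rewrite invgM invgK !mulgA mulgVK mulgVK.
apply: contrapT => hn.
have dis e : e \in E -> [disjoint frmul L v & frmul L (fsval e)]%fset.
  move=> eIn; apply/negPn/negP => /fdisjointPn[g gv ge].
  by apply: hn; exists e => //; exists g.
have vE : [` vW]%fset \notin E.
  apply/negP => /dis; apply/negP/fdisjointPn.
  have /fset0Pn[a aL] := L0.
  by exists (a * v)%g; rewrite mem_frmul mulgK.
have : admissible act X L x (finset.setU (finset.set1 [` vW]%fset) E).
  move: adE => /and3P[/existsP[e0 /andP[e0E e01]] /forallP dE /forallP rE].
  apply/and3P; split.
  - by apply/existsP; exists e0; rewrite finset.in_setU e0E orbT.
  - apply/forallP => e; apply/implyP; rewrite finset.in_setU1 => eIn.
    apply/forallP => e'; apply/implyP; rewrite finset.in_setU1 => eE'.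
    apply/implyP => ne; case/predU1P: eIn => [ev|eIn]; case/predU1P: eE' => [ev'|eE'].
    + by rewrite ev ev' eqxx in ne.
    + by rewrite ev; exact: dis.
    + by rewrite ev' fdisjoint_sym; exact: dis.
    + by have /implyP/(_ eIn)/forallP/(_ e')/implyP/(_ eE')/implyP/(_ ne) := dE e.
  - apply/forallP => e; apply/implyP; rewrite finset.in_setU1 => /predU1P[->//|].
    by have /implyP := rE e.
move=> /(@leq_bigmax_cond _ _ (fun E : {set W} => #|E|) _).
by rewrite -/(maxE x) maxEE finset.cardsU1 vE ltnn.
Qed.

Variables (C th : R) (Ty : pred {ffun L -> Sg}).
Hypotheses (C0 : 0 < C) (WC : individually_filling W C) (th0 : 0 <= th).

Definition seldom : set T := [set x | Ty (word L x) /\ Ufun R act X L W x < th].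

Lemma measurable_seldom : measurable seldom.
Proof.
apply: (@measurable_local (L `|` Defs.fprod L W)%fset) => x x' e [h1 h2].
by split; [rewrite -(word_setU e)|rewrite -(eq_Ufun e)].
Qed.

(** If [f x] is seldom and carries [w], the times in [W f] at which [w] occurs correspond, after
    translation by [f^-1], to return times of [f x] in [W]. There are at most [|L|^2 th |W|] of
    these, so the count by filling translates applies. *)
Lemma card_seldom_le (V : {fset G}) (w : {ffun L -> Sg}) x :
  C * #|` [fset a in V | (act a x \in seldom) && (word L (act a x) == w)]%fset|%:R <=
  (#|` L| * #|` L|)%:R * th * #|` Defs.fprod W V|%:R.
Proof.
set A := [fset a in V | _]%fset.
have c0 : 0 <= (#|` L| * #|` L|)%:R * th by rewrite mulr_ge0.
apply: (@le_trans _ _ ((#|` L| * #|` L|)%:R * th * #|` Defs.fprod W A|%:R)); last first.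
  rewrite ler_wpM2l// ler_nat; apply/fsubset_leq_card/fsubsetP => a.
  move=> /imfset2P[v vW [b]]; rewrite !inE => /andP[bV _] ->.
  by apply/imfset2P; exists v => //; exists b.
apply: filling_count => // f; rewrite !inE => /andP[fV /andP[]].
rewrite inE => -[_ Uf] /eqP fw.
apply: (@le_trans _ _ (#|` L| * #|` L| * maxE (act f x))%:R).
  rewrite ler_nat; apply: leq_trans (card_repeats _).
  rewrite -(card_frmul _ f^-1); apply/fsubset_leq_card/fsubsetP => v.
  rewrite mem_frmul invgK !inE mem_frmul mulgK => /andP[/andP[_ /andP[_ /eqP vw]] vW].
  rewrite vW/=; apply/forallP => g; apply/eqP.
  have := congr1 (fun u : {ffun L -> Sg} => u g) (etrans vw (esym fw)).
  by rewrite !ffunE actM.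
have W0 : 0 < #|` W|%:R :> R by rewrite ltr0n cardfs_gt0; apply/fset0Pn; exists 1%g.
rewrite natrM -mulrA ler_wpM2l// ltW//.
by move: Uf; rewrite /Ufun ltr_pdivrMr.
Qed.

(** The count along an orbit window [V] is summed over the words in [Ty] and integrated; invariance
    of the measure turns its left side into [|V|] times the probability, and [|V|] cancels. *)
Lemma prob_seldom (V : {fset G}) : V != fset0 ->
  #|` Defs.fprod W V|%:R <= 2 * #|` V|%:R :> R ->
  fine (P seldom) <= #|Ty|%:R * ((#|` L| * #|` L|)%:R * th * 2 / C).
Proof.
move=> V0 WV; have mB := measurable_seldom.
have VR : 0 < #|` V|%:R :> R by rewrite ltr0n cardfs_gt0.
set c := _ / C; have c0 : 0 <= #|` V|%:R * c.
  by rewrite mulr_ge0// divr_ge0 ?mulr_ge0// ltW.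
have pt x : orbsum act V (\1_seldom) x <= #|Ty|%:R * (#|` V|%:R * c).
  have -> : orbsum act V (\1_seldom) x =
    \sum_(a <- V | act a x \in seldom) 1 :> R.
    rewrite [RHS]big_mkcond/=.
    by apply: eq_bigr => a _; rewrite indicE; case: (_ \in _).
  rewrite (partition_big (fun a => word L (act a x)) Ty)/=; last first.
    by move=> a; rewrite inE => -[].
  rewrite mulr_natl -sumr_const; apply: ler_sum => w _.
  have := card_seldom_le V w x.
  rewrite card_fset_sum1 natr_sum big_fset/= => h.
  rewrite /c mulrA ler_pdivlMr// mulrC; apply: le_trans h _.
  have -> : #|` V|%:R * ((#|` L| * #|` L|)%:R * th * 2) =
    (#|` L| * #|` L|)%:R * th * (2 * #|` V|%:R) by ring.
  by rewrite ler_wpM2l// mulr_ge0.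
have bB := bdm_indic R mB.
have := le_mean P (bdm_orbsum mp V bB) (bdm_cst T _) pt.
rewrite mean_cst mean_orbsum// mean_indic// mulrCA ler_pM2l//.
Qed.

End Recurrence.

(** * Typical words *)

Lemma limn_esup_le_near (R : realType) (u : (\bar R)^nat) (c : \bar R) :
  (\forall k \near \oo, (u k <= c)%E) -> (limn_esup u <= c)%E.
Proof.
move=> [N _ hN]; rewrite limn_esup_lim.
apply: lime_le; first exact: is_cvg_esups.
exists N => // n /= Nn; apply: ge_ereal_sup => _ [k /= nk <-].
by apply: hN => /=; exact: leq_trans nk.
Qed.

(** Square of [y <= expR y] at [y = a t / 2]; it serves to absorb the factor [|F_k|^2] from the
    count of return times. *)
Lemma sqr_le_expR (R : realType) (a t : R) : 0 < a -> 0 <= t ->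
  t * t <= 4 / (a * a) * expR (a * t).
Proof.
move=> a0 t0; rewrite mulrAC ler_pdivlMr ?mulr_gt0//.
have -> : t * t * (a * a) = 4 * ((a * t / 2) * (a * t / 2)) by field.
rewrite ler_pM2l//.
have -> : a * t = a * t / 2 + a * t / 2 by field.
have h : 0 <= a * t / 2 by rewrite divr_ge0// mulr_ge0// ltW.
have h1 : a * t / 2 <= expR (a * t / 2).
  by apply: le_trans (expR_ge1Dx _); rewrite lerDr.
have -> : (a * t / 2 + a * t / 2) / 2 = a * t / 2 by field.
by rewrite expRD ler_pM.
Qed.

Section TypicalWords.
Variables (G : groupType) (R : realType) (d : measure_display) (T : measurableType d).
Variables (P : probability T R) (act : G -> T -> T) (Sg : finType) (X : T -> Sg).
Variables (h : R) (F : nat -> {fset G}).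
Hypotheses (cG : countable_group G) (mp : mp_action P act)
  (erg : ergodic_action P act) (mX : measurable_obs X).
Hypothesis entropy_h :
  (fun k => block_entropy P act X (F k) / (#|` F k|)%:R) @ \oo --> h.
Hypothesis tF : tempered_folner R F.
Hypothesis F0 : forall k, (k <= #|` F k|)%N.

Let actM g g' x : act (g * g')%g x = act g (act g' x).
Proof. by case: mp => _ []. Qed.

Let folner g :
  (fun n => #|` lsdiff g (F n)|%:R / (#|` F n|)%:R : R) @ \oo --> (0 : R).
Proof. by case: tF => + _; apply. Qed.

Lemma pat_prob_word (K : {fset G}) (w : {ffun K -> Sg}) :
  pat_prob P act X w = fine (P [set x | word act X K x = w]).
Proof.
rewrite /pat_prob; congr (fine (P _)); apply/seteqP; split => x /= hx.
  by apply/ffunP => g; rewrite ffunE.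
by move=> g; rewrite -hx ffunE.
Qed.

Lemma wordE (K : {fset G}) (phi : {ffun K -> Sg} -> R) x :
  phi (word act X K x) = \sum_w phi w * \1_[set x | word act X K x = w] x.
Proof.
rewrite (bigD1 (word act X K x))//= indicE mem_set// mulr1 big1 ?addr0// => w /eqP ne.
by rewrite indicE memNset ?mulr0// => e; apply: ne.
Qed.

Lemma bdm_word (K : {fset G}) (phi : {ffun K -> Sg} -> R) :
  bdm (fun x => phi (word act X K x)).
Proof.
under eq_fun do rewrite wordE.
apply: bdm_sum => w; apply/bdmZ/bdm_indic; exact: (measurable_word mp mX).
Qed.

Lemma mean_word (K : {fset G}) (phi : {ffun K -> Sg} -> R) :
  mean P (fun x => phi (word act X K x)) = \sum_w pat_prob P act X w * phi w.
Proof.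
under [X in mean _ X]eq_fun do rewrite wordE.
rewrite mean_sum => [|w]; last by apply/bdmZ/bdm_indic; exact: (measurable_word mp mX).
apply: eq_bigr => w _.
rewrite meanZ; last by apply: bdm_indic; exact: (measurable_word mp mX).
by rewrite mean_indic ?pat_prob_word 1?mulrC//; exact: (measurable_word mp mX).
Qed.

Lemma sum_pat_prob (K : {fset G}) : \sum_w pat_prob P act X (F := K) w = 1.
Proof.
have := mean_word (fun _ : {ffun K -> Sg} => 1); rewrite mean_cst => ->.
by apply: eq_bigr => w _; rewrite mulr1.
Qed.

Lemma pattern_word (K L : {fset G}) (s0 : Sg) (f : G) x :
  f \in L -> inner K L f -> pattern s0 K f (word act X L x) = word act X K (act f x).
Proof.
move=> fL fi; apply/ffunP => g; rewrite !ffunE.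
have gL := inner_mem fL fi (fsvalP g).
rewrite -[(fsval g * f)%g]/(fsval [` gL]%fset) extend_val ffunE /=.
by rewrite actM.
Qed.

(* The additive constant [eta] makes every weight positive, so that no word has
   infinite code length. *)
Lemma smoothed_code (K : {fset G}) (t : R) : 0 < t -> exists phi : {ffun K -> Sg} -> R,
  [/\ \sum_w expR (- phi w) <= 1, forall w, 0 <= phi w &
      mean P (fun x => phi (word act X K x)) <= ln 2 * block_entropy P act X K + t].
Proof.
move=> t0; set n : R := #|{ffun K -> Sg}|%:R.
have n0 : 0 < n by rewrite ltr0n; apply/card_gt0P; exists (word act X K point).
(* The smoothed weights have total mass [1 + t], and normalising them costs [ln (1 + t) <= t]. *)
pose eta := t / n; have eta0 : 0 < eta by rewrite divr_gt0.
have p0 w : 0 <= pat_prob P act X (F := K) w by rewrite fine_ge0.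
have q0 w : 0 < pat_prob P act X (F := K) w + eta by rewrite ltr_wpDl.
have t1 : 0 < 1 + t by rewrite addr_gt0.
have sumq : \sum_w (pat_prob P act X (F := K) w + eta) = 1 + t.
  rewrite big_split/= sum_pat_prob sumr_const; congr (1 + _).
  by rewrite -[LHS]mulr_natr -/n /eta mulfVK// gt_eqF.
pose phi (w : {ffun K -> Sg}) := ln (1 + t) - ln (pat_prob P act X w + eta).
exists phi; split.
- rewrite le_eqVlt; apply/orP; left; apply/eqP.
  under eq_bigr => w _ do rewrite /phi opprB expRD expRN !lnK ?posrE//.
  by rewrite -mulr_suml sumq divff// gt_eqF.
- move=> w; rewrite /phi subr_ge0 ler_ln ?posrE// -sumq.
  rewrite (bigD1 w)//= lerDl sumr_ge0// => v _.
  exact: ltW.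
rewrite mean_word /block_entropy mulr_sumr.
rewrite (_ : t = \sum_w pat_prob P act X (F := K) w * t); last first.
  by rewrite -mulr_suml sum_pat_prob mul1r.
rewrite -big_split/=; apply: ler_sum => w _.
rewrite /phi /log2.
have ln20 : 0 < ln 2 :> R by rewrite ln_gt0// ltr1n.
set p := pat_prob _ _ _ w.
have -> : ln 2 * (- (p * (ln p / ln 2))) = - (p * ln p) by field; rewrite gt_eqF.
have [->|pn0] := eqVneq p 0; first by rewrite !mul0r oppr0 addr0.
have pp : 0 < p by rewrite lt_neqAle eq_sym pn0 p0.
have : ln p <= ln (p + eta) by rewrite ler_ln ?posrE ?addr_gt0// lerDl ltW.
have : ln (1 + t) <= t by rewrite le_ln1Dx// (lt_trans _ t0)// ltrN10.
move=> h1 h2.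
have -> : - (p * ln p) + p * t = p * (t - ln p) by ring.
by rewrite ler_pM2l//; lra.
Qed.

(** A word on [F k] counts as typical when the code lengths of its inner [K]-patterns have a small
    sum. The weight estimate makes such words few, and the pointwise ergodic theorem for the code
    length on [K] makes almost every point produce them eventually. The factor [ln 2] converts bits
    into the nats of [expR]. *)
Lemma typical_words (dl : R) : 0 < dl ->
  exists Ty : forall k, pred {ffun F k -> Sg},
    (\forall k \near \oo,
       #|Ty k|%:R <= expR (ln 2 * (h + dl) * #|` F k|%:R)) /\
    P.-negligible [set x | ~ \forall k \near \oo, Ty k (word act X (F k) x)].
Proof.
move=> dl0.
have ln20 : 0 < ln 2 :> R by rewrite ln_gt0// ltr1n.
have dl8 : 0 < dl / 8 by rewrite divr_gt0.
have [m [m1 hm]] : exists m, (1 <= m)%N /\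
    block_entropy P act X (F m) / #|` F m|%:R <= h + dl / 8.
  have hd : h < h + dl / 8 by rewrite ltrDl.
  have [m0 _ hm0] := cvgr_le _ entropy_h _ hd.
  by exists m0.+1; split=> //; exact: (hm0 _ (leqnSn _)).
set K := F m in hm.
have r0 : (0 < #|` K|)%N by apply: leq_trans (F0 m).
have K0 : K != fset0 by rewrite -cardfs_gt0.
have rR : 1 <= #|` K|%:R :> R by rewrite ler1n.
set r : R := #|` K|%:R in rR hm.
have r0R : 0 < r by rewrite (lt_le_trans _ rR).
have t0 : 0 < ln 2 * (dl / 8) by rewrite mulr_gt0.
have [phi [phi1 phi0 phiE]] := smoothed_code K t0.
pose f x := phi (word act X K x).
have bf : bdm f by exact: bdm_word.
have fE : mean P f <= r * (ln 2 * (h + dl / 4)).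
  apply: le_trans phiE _.
  rewrite ler_pdivrMr// in hm.
  apply: (@le_trans _ _ (ln 2 * ((h + dl / 8) * r) + ln 2 * (dl / 8) * r)).
    rewrite lerD//; first by rewrite ler_pM2l.
    by rewrite ler_peMr// ltW.
  by rewrite le_eqVlt; apply/orP; left; apply/eqP; field.
(* Budget for [dl]: [dl / 4] in the mean of [f], [dl / 4] for the ergodic deviation, and [dl / 2]
   left for the boundary in the count. *)
pose c k := ln 2 * (h + dl / 2) * #|` F k|%:R.
pose s0 : Sg := X point.
pose Ty k := [pred y : {ffun F k -> Sg} |
  \sum_(a : F k | inner K (F k) (fsval a)) phi (pattern s0 K (fsval a) y) <= r * c k].
exists Ty; split.
  pose lnN : R := ln #|Sg|%:R.
  have lnN0 : 0 <= lnN by rewrite ln_ge0// ler1n; apply/card_gt0P; exists s0.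
  have e3 : 0 < ln 2 * (dl / 2) / (lnN + 1).
    by rewrite divr_gt0 ?ltr_wpDl// mulr_gt0// divr_gt0.
  have [k0 _ hk0] := @folner_boundary _ _ _ folner F0 K _ e3.
  exists k0 => // k /hk0 hb.
  apply: (@le_trans _ _ (expR (c k + #|` boundary K (F k)|%:R * lnN))).
    exact: card_typical.
  rewrite ler_expR.
  have : #|` boundary K (F k)|%:R * lnN <= ln 2 * (dl / 2) * #|` F k|%:R.
    apply: (@le_trans _ _ (#|` boundary K (F k)|%:R * (lnN + 1))).
      by rewrite ler_wpM2l// lerDl.
    rewrite -ler_pdivlMr ?ltr_wpDl//; apply: le_trans hb _.
    by rewrite mulrAC.
  rewrite -/lnN /c => hb2; apply: le_trans (lerD (lexx _) hb2) _.
  by rewrite le_eqVlt; apply/orP; left; apply/eqP; field.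
have e4 : 0 < r * (ln 2 * (dl / 8)) by rewrite mulr_gt0.
have negZ := @pointwise_ergodic _ _ _ _ P act F cG mp erg folner F0.
have [C temper] := (tF).2.
apply: negligibleS (negZ C temper f _ bf e4) => x /= nx.
apply: contrapT => Zx; apply: nx.
have [k0 _ hk0] := lim_sup_setPn Zx.
exists k0 => // k /hk0 /= /negP; rewrite -ltNge ltr_norml => /andP[_ hk].
apply: (@le_trans _ _ (orbsum act (F k) f x)).
  apply: (@le_trans _ _ (\sum_(a : F k | inner K (F k) (fsval a)) f (act (fsval a) x))).
    by apply: ler_sum => a ai; rewrite pattern_word//; exact: fsvalP.
  (* Dropping the boundary translates only lowers the sum, since [phi] is nonnegative. *)
  rewrite /orbsum [leRHS]big_seq_fsetE/= [leRHS](bigID (fun a => inner K (F k) (fsval a)))/=.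
  by rewrite lerDl; apply: sumr_ge0 => a _; exact: phi0.
have : mean P f * #|` F k|%:R <= r * (ln 2 * (h + dl / 4)) * #|` F k|%:R.
  by rewrite ler_wpM2r.
move: hk; rewrite ltrBlDr => hk hE; apply: le_trans (ltW hk) _.
apply: le_trans (lerD (lexx _) hE) _.
by rewrite /c le_eqVlt; apply/orP; left; apply/eqP; field.
Qed.

End TypicalWords.

(** * Almost sure lower bound for the return frequency *)

Unset Implicit Arguments.

Theorem theorem3p3 (G : groupType) (R : realType) (d : measure_display)
  (T : measurableType d) (P : probability T R) (act : G -> T -> T)
  (Sigma : finType) (X : T -> Sigma) (h : R)
  (F W : nat -> {fset G}) (C : nat -> R) (n : nat -> nat) :
  countable_group G ->
  mp_action P act -> free_action act -> ergodic_action P act ->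
  measurable_obs X ->
  (fun k => block_entropy P act X (F k) / (#|` F k|)%:R) @ \oo --> h ->
  tempered_folner R F ->
  (forall k, (k <= #|` F k|)%N) ->
  (forall m, 1%g \in W m) ->
  (forall m, 0 < C m) ->
  (forall m, individually_filling (W m) (C m)) ->
  (forall alpha : R, 0 < alpha ->
     (\sum_(1 <= k <oo) ((2 `^ (- alpha * (#|` F k|)%:R)) / C (n k))%:E < +oo)%E) ->
  {ae P, forall x : T,
     (limn_esup (fun k =>
        (- (1 / (#|` F k|)%:R) * log2 (Ufun R act X (F k) (W (n k)) x))%:E)
      <= h%:E)%E}.
Proof.
move=> cG mp _ erg mX entropy_h tF F0 W1 C0 WC sumC.
have ln20 : 0 < ln 2 :> R by rewrite ln_gt0// ltr1n.
have folner := tF.1.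
pose val k x := - (1 / (#|` F k|)%:R) * log2 (Ufun R act X (F k) (W (n k)) x).
suff bad dl : 0 < dl -> P.-negligible [set x | ~ \forall k \near \oo, val k x <= h + dl].
  (* Countably many margins [dl = 1 / (j + 1)] suffice. *)
  apply: (@negligibleS _ _ _ _ (\bigcup_j [set x |
      ~ \forall k \near \oo, val k x <= h + j.+1%:R^-1])); last first.
    by apply: negligible_bigcup => j; apply: bad; rewrite invr_gt0.
  move=> x /= nx; apply: contrapT => hx; apply: nx.
  apply/lee_addgt0Pr => e e0.
  have [j ej] : exists j : nat, j.+1%:R^-1 <= e.
    exists (Num.truncn e^-1); rewrite invf_ple ?posrE//.
    exact/ltW/truncnS_gt.
  apply: (@le_trans _ _ (h + j.+1%:R^-1)%:E); last by rewrite -EFinD lee_fin lerD2l.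
  apply: limn_esup_le_near.
  have : \forall k \near \oo, val k x <= h + j.+1%:R^-1.
    by apply: contrapT => hj; apply: hx; exists j.
  by apply: filterS => k; rewrite lee_fin.
move=> dl0; have dl2 : 0 < dl / 2 by rewrite divr_gt0.
have [Ty [[k1 _ hk1] negTy]] := typical_words cG mp erg mX entropy_h tF F0 dl2.
pose t k : R := #|` F k|%:R.
(* This is [2^(-(h + dl) |F_k|)], so that for nonempty [F k] the bound [val k x <= h + dl] says that
   the return frequency is at least [th k]. *)
pose th k := expR (- (ln 2 * (h + dl)) * t k).
pose B k := seldom act X (W (n k)) (th k) (Ty k).
have mB k : measurable (B k) by exact: (measurable_seldom mp mX).
(* Of the exponent gap [dl / 2] between the number of typical words and [th k], one half absorbs
   [|F_k|^2] and the other half is the decay rate fed to the summability hypothesis. *)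
pose a := ln 2 * (dl / 4); have a0 : 0 < a by rewrite mulr_gt0// divr_gt0.
pose c := 2 * (4 / (a * a)).
have c0 : 0 <= c by rewrite mulr_ge0// divr_ge0// mulr_ge0// ltW.
have PB k : (k1 <= k)%N -> (1 <= k)%N ->
    fine (P (B k)) <= c * (2 `^ (- (dl / 4) * t k) / C (n k)).
  move=> kk1 kp.
  have Fk0 : F k != fset0 by rewrite -cardfs_gt0; apply: leq_trans (F0 k).
  have [V [V0 WV]] : exists V : {fset G}, V != fset0 /\
      #|` Defs.fprod (W (n k)) V|%:R <= 2 * #|` V|%:R :> R.
    have [m0 _ hm] := @folner_fprod _ _ _ folner F0 (W (n k)).
    exists (F m0.+1); split; last exact: (hm _ (leqnSn _)).
    by rewrite -cardfs_gt0; apply: leq_trans (F0 _).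
  have th0 : 0 <= th k by exact: expR_ge0.
  apply: le_trans (prob_seldom mp mX Fk0 (W1 _) (Ty k) (C0 _) (WC _) th0 V0 WV) _.
  rewrite !mulrA ler_pM2r ?invr_gt0// natrM -/(t k).
  have tt : t k * t k <= 4 / (a * a) * expR (a * t k) by exact: sqr_le_expR.
  have -> : 2 `^ (- (dl / 4) * t k) = expR (- (a * t k)).
    rewrite /powR pnatr_eq0/=; congr expR; rewrite /a; ring.
  apply: (@le_trans _ _ (expR (ln 2 * (h + dl / 2) * t k) *
      (4 / (a * a) * expR (a * t k)) * th k * 2)).
    rewrite ler_wpM2r// ler_wpM2r// -mulrA ler_pM ?mulr_ge0//.
    by rewrite mulrA; exact: hk1.
  rewrite /c /th le_eqVlt; apply/orP; left; apply/eqP.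
  have -> : - (a * t k) = ln 2 * (h + dl / 2) * t k + a * t k +
      - (ln 2 * (h + dl)) * t k by rewrite /a; field.
  by rewrite !expRD; ring.
(* Cutting off the first indices leaves the upper limit set unchanged and allows a comparison with
   the convergent series term by term; [k1 < k] also gives [1 <= k]. *)
pose B' k := if (k1 < k)%N then B k else set0.
have mB' k : measurable (B' k) by rewrite /B'; case: ifP.
have negB : P.-negligible (lim_sup_set B').
  apply/negligibleP; first exact: measurable_lim_sup_set.
  apply: lim_sup_set_cvg0 => //.
  have u0 k : (0 <= ((2 `^ (- (dl / 4) * t k)) / C (n k))%:E)%E.
    by rewrite lee_fin divr_ge0 ?powR_ge0// ltW.
  pose v k := if (1 <= k)%N then ((2 `^ (- (dl / 4) * t k)) / C (n k))%:E else 0%E.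
  apply: (@le_lt_trans _ _ (\sum_(k <oo) (c%:E * v k))%E).
    apply: lee_nneseries => // k _; rewrite /B' /v.
    case: ifPn => [kk1|_]; last first.
      by rewrite measure0 mule_ge0//; case: ifP.
    rewrite (leq_ltn_trans _ kk1)// -[leLHS](fine_prob P (mB k)) -EFinM lee_fin.
    by apply: PB; [exact: ltnW|exact: leq_ltn_trans kk1].
  rewrite nneseriesZl => [|k _]; last by rewrite /v; case: ifP.
  rewrite lte_mul_pinfty// /v -eseries_mkcond.
  have := sumC _ (divr_gt0 dl0 (ltr0n R 4)).
  by rewrite eseries_cond.
apply: negligibleS (negligibleU negTy negB) => x /= nx.
apply: contrapT => /not_orP[/contrapT [k2 _ hk2] nB']; apply: nx.
have [k3 _ hk3] := lim_sup_setPn nB'.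
exists (maxn k1.+1 (maxn k2 k3)) => // k /=.
rewrite !geq_max => /andP[kk1 /andP[/hk2/= tyk /hk3]].
rewrite /B' kk1 => nB.
have tk0 : 0 < t k by rewrite ltr0n; apply: leq_trans (F0 k); apply: leq_ltn_trans kk1.
have U0 := Ufun_gt0 X mp (F k) (W1 (n k)) x.
have Uge : th k <= Ufun R act X (F k) (W (n k)) x.
  by rewrite leNgt; apply/negP => U; apply: nB; split.
rewrite /val /log2 mulNr lerNl mul1r -/(t k).
have -> : - (h + dl) = (t k)^-1 * (- (ln 2 * (h + dl)) * t k / ln 2).
  by field; rewrite !gt_eqF.
rewrite ler_pM2l ?invr_gt0// ler_pM2r ?invr_gt0//.
by rewrite -ler_expR lnK// posrE.
Qed.
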